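(* Let $Q>1$ and $\epsilon>0$. Let $(X,d,\mu)$ be a $Q$-doubling metric measure space which satisfies a chain condition. Let $u:X\to\mathbb{R}$ be integrable on balls and let $g\in L^Q(X)$, $g\ge 0$, be such that there exist constants $C>0$ and $\lambda\ge 1$ with $$\frac{1}{\mu(B)}\int_B |u-u_B|\,d\mu\le C\,\operatorname{diam}(B)\left(\frac{1}{\mu(\lambda B)}\int_{\lambda B} g^Q\,d\mu\right)^{1/Q}$$ for every open ball $B\subset X$, where $u_B=\frac{1}{\mu(B)}\int_B u\,d\mu$. Then there is a set $E_\epsilon\subset X$ with $H^h(E_\epsilon)=0$, where $h(t)=\log^{1-Q-\epsilon}(1/t)$, such that for every $x\in X\setminus E_\epsilon$ the limit $$\lim_{r\to 0}\frac{1}{\mu(B(x,r))}\int_{B(x,r)}u(y)\,d\mu(y)$$ exists, and (replacing $u$ by this limit, which gives a representative of $u$) one has $u(x)=\lim_{r\to 0}\frac{1}{\mu(B(x,r))}\int_{B(x,r)}u\,d\mu$ for all $x\in X\setminus E_\epsilon$.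
   Context: $\mu$ is a Borel regular outer measure on the metric space $(X,d)$. $\mu$ is doubling if every ball has positive finite measure and $\mu(B(x,2r))\le C_\mu\mu(B(x,r))$ for all $x\in X$, $r>0$. $(X,d,\mu)$ is $Q$-doubling if $\mu$ is doubling and there is $C\ge1$ with $(s/r)^Q\le C\,\mu(B(x,s))/\mu(B(a,r))$ whenever $a\in X$, $x\in B(a,r)$, $0<s\le r$. For a ball $B=B(x,r)=\{y:d(x,y)<r\}$, $\lambda B=B(x,\lambda r)$. Chain condition: for every $\lambda\ge1$ there are constants $M\ge1$, $0<m\le1$ such that for each $x\in X$ and all $0<r<\operatorname{diam}(X)/8$ there is a sequence of balls $B_0,B_1,\dots$ with (1) $B_0\subset X\setminus B(x,r)$; (2) $M^{-1}\operatorname{diam}(B_i)\le \operatorname{dist}(x,B_i)\le M\operatorname{diam}(B_i)$; (3) $\operatorname{dist}(x,B_i)\le Mr2^{-mi}$; (4) there is a ball $D_i\subset B_i\cap B_{i+1}$ with $B_i\cup B_{i+1}\subset MD_i$, for all $i\ge0$; (5) no point of $X$ belongs to more than $M$ of the balls $\lambda B_i$. Generalized Hausdorff measure: $H^h(E)=\limsup_{\delta\to0}H^h_\delta(E)$, $H^h_\delta(E)=\inf\{\sum_i h(\operatorname{diam}(B_i)): E\subset\bigcup_i B_i,\ \operatorname{diam}(B_i)\le\delta\}$. *)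

(* Defs.v *)
From HB Require Import structures.
From mathcomp Require Import all_boot all_order all_algebra.
From mathcomp Require Import all_classical all_reals all_analysis.
Set Implicit Arguments. Unset Strict Implicit. Unset Printing Implicit Defensive.
Import Order.TTheory GRing.Theory Num.Theory.
Import numFieldNormedType.Exports.
Local Open Scope classical_set_scope.
Local Open Scope ring_scope.

Section Defs.
Variables (R : realType) (X : Type) (dist : X -> X -> R).

Definition is_metric : Prop :=
  [/\ forall x y, 0 <= dist x y,
      forall x y, dist x y = 0 <-> x = y,
      forall x y, dist x y = dist y x &
      forall x y z, dist x z <= dist x y + dist y z].

Definition dball (x : X) (r : R) : set X := [set y | dist x y < r].

Definition ballp (B : X * R) : set X := dball B.1 B.2.
Definition sball (l : R) (B : X * R) : X * R := (B.1, l * B.2).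

Definition d_open (A : set X) : Prop :=
  forall x, A x -> exists2 r : R, 0 < r & dball x r `<=` A.

(* diameter, in the extended reals (so diam X may be +oo) *)
Definition diam (A : set X) : \bar R :=
  ereal_sup [set (dist a b)%:E | a in A & b in A].

Definition distp (x : X) (A : set X) : R := inf [set dist x y | y in A].

Definition chain_condition : Prop :=
  forall lam : R, 1 <= lam ->
  exists M : R, exists m : R, [/\ 1 <= M, 0 < m, m <= 1 &
    forall (x : X) (r : R), 0 < r -> (r%:E < diam setT * (8^-1)%:E)%E ->
    exists B : nat -> X * R,
    [/\ (forall i, 0 < (B i).2) /\
        ballp (B 0%N) `<=` ~` dball x r,
        (forall i, (M^-1)%:E * diam (ballp (B i)) <= (distp x (ballp (B i)))%:E
                   /\ (distp x (ballp (B i)))%:E <= M%:E * diam (ballp (B i)))%E,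
        (forall i : nat, distp x (ballp (B i)) <= M * r * powR 2 (- (m * i%:R))),
        (forall i, exists D : X * R, 0 < D.2 /\
            ballp D `<=` setI (ballp (B i)) (ballp (B i.+1)) /\
            ballp (B i) `|` ballp (B i.+1) `<=` ballp (sball M D)) &
        (forall (y : X) (s : seq nat), uniq s ->
            (forall i, i \in s -> ballp (sball lam (B i)) y) -> (size s)%:R <= M)]].

Definition hausdorff_delta (h : R -> R) (delta : R) (E : set X) : \bar R :=
  ereal_inf [set (\sum_(0 <= i <oo) (h (fine (diam (ballp (B i)))))%:E)%E
            | B in [set B : nat -> X * R |
                (forall i, 0 < (B i).2) /\
                E `<=` \bigcup_i ballp (B i) /\
                (forall i, diam (ballp (B i)) <= delta%:E)%E]].

(* H^h(E) = lim_{delta -> 0} H^h_delta(E); H^h_delta is nonincreasing in delta,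
   so this limit (= limsup) is the supremum over delta > 0 *)
Definition hausdorff (h : R -> R) (E : set X) : \bar R :=
  ereal_sup [set hausdorff_delta h delta E | delta in [set d : R | 0 < d]].

End Defs.

Definition gauge_log (R : realType) (Q eps : R) (t : R) : R :=
  if t <= 0 then 0 else powR (ln (t^-1)) (1 - Q - eps).

Section Meas.
Context (R : realType) (d : measure_display) (X : measurableType d).

Definition avg (mu : {measure set X -> \bar R}) (f : X -> R) (A : set X) : R :=
  (fine (mu A))^-1 * fine (\int[mu]_(y in A) (f y)%:E)%E.
End Meas.

(* Main.v *)
(* Write [nu A] for the integral of [g ^ Q] over [A].  The Poincare inequality
   and the lower mass bound [r ^ Q <= c * mu (B(y, r))] bound the oscillation of
   [u] on a small ball [B] near [x] by a multiple of [nu (lam B) ^ (1 / Q)].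
   Fix [beta] strictly between [Q - 1] and [Q - 1 + eps], let
   [rho j = 2 ^ - (2 ^ j)], and let [E] be the set of the [x] such that
   [nu (B(x, rho j)) > 2 ^ - (j * beta)] for infinitely many [j].

   Outside [E], the balls [lam B_i] of a chain at [x] with [2 ^ k <= i < 2 ^ (k + 1)]
   lie in [B(x, rho (k - c))] and have bounded overlap, so the sum of their
   [nu]-masses is [O(2 ^ - (k * beta))].  As [beta > Q - 1], the sum over all [i]
   of [nu (lam B_i) ^ (1 / Q)] converges.  Hence the averages of [u] on the [B_i]
   converge, and every average [u_{B(x, s)}] is close to one of them.

   The points contributed to [E] by a single [j] are covered by at most
   [nu X * 2 ^ (j * beta)] balls of radius [2 * rho j], whose gauge is
   [O(2 ^ - (j * (Q - 1 + eps)))]; the total is summable in [j].  Because [log]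
   does not separate the radii between [rho (j + 1)] and [rho j], one radius per
   [j] is enough and no Vitali covering is needed.

   That the limit is [u] almost everywhere needs no Lebesgue differentiation
   theorem: the Poincare inequality, summed over a finite [r]-net, bounds the
   [L ^ 1] distance between [u] and its averages at scale [r] by [O(r)], so along
   a fast sequence of scales the averages converge to [u] almost everywhere. *)
Require Import Defs.
From HB Require Import structures.
From mathcomp Require Import all_boot all_order all_algebra.
From mathcomp Require Import all_classical all_reals all_analysis.
From mathcomp Require Import measurable_realfun lra ring.
Import Order.TTheory GRing.Theory Num.Theory.
Import numFieldNormedType.Exports.
Local Open Scope classical_set_scope.
Local Open Scope ring_scope.

(** * Balls, diameters and the chain condition *)

Section Metric.
Context (R : realType) (X : Type) (dist : X -> X -> R).
Hypothesis hd : is_metric dist.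

Lemma dist_ge0 x y : 0 <= dist x y.
Proof. by case: hd. Qed.

Lemma dist_xx x : dist x x = 0.
Proof. by case: hd => _ h _ _; apply/h. Qed.

Lemma dist_sym x y : dist x y = dist y x.
Proof. by case: hd. Qed.

Lemma dist_tri y x z : dist x z <= dist x y + dist y z.
Proof. by case: hd. Qed.

Lemma dball_self x r : 0 < r -> dball dist x r x.
Proof. by rewrite /dball /= dist_xx. Qed.

Lemma dball_sub x y r s : dist y x + r <= s -> dball dist x r `<=` dball dist y s.
Proof.
move=> h z; rewrite /dball /= => zr.
by have := dist_tri x y z; lra.
Qed.

Lemma dball_open x r : d_open dist (dball dist x r).
Proof.
move=> y /= yr; exists (r - dist x y); first by rewrite subr_gt0.
by apply: dball_sub; rewrite addrC subrK.
Qed.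

Lemma le_diam (A : set X) a b : A a -> A b -> ((dist a b)%:E <= diam dist A)%E.
Proof. by move=> Aa Ab; apply: ereal_sup_ubound; exists a => //; exists b. Qed.

Lemma diam_dball_le x r : (diam dist (dball dist x r) <= (2 * r)%:E)%E.
Proof.
apply: ge_ereal_sup => _ [a xa [b xb <-]]; rewrite lee_fin.
move: xa xb; rewrite /dball /= => xa xb.
by have := dist_tri x a b; rewrite (dist_sym a x); lra.
Qed.

Lemma diam_dball_fin x r : 0 < r -> diam dist (dball dist x r) \is a fin_num.
Proof.
move=> r0; have xr := dball_self x r r0.
have h1 := le_diam _ _ _ xr xr; have h2 := diam_dball_le x r.
apply/fin_real/andP; split.
  by apply: lt_le_trans h1; rewrite ltNyr.
by apply: le_lt_trans h2 _; rewrite ltry.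
Qed.

Lemma dist_le_diam x r a b : 0 < r -> dball dist x r a -> dball dist x r b ->
  dist a b <= fine (diam dist (dball dist x r)).
Proof.
move=> r0 ha hb; have := le_diam _ _ _ ha hb.
by rewrite -{1}(fineK (diam_dball_fin x r r0)) lee_fin.
Qed.

Lemma fine_diam_le x r : 0 < r -> fine (diam dist (dball dist x r)) <= 2 * r.
Proof.
move=> r0; have := diam_dball_le x r.
by rewrite -{1}(fineK (diam_dball_fin x r r0)) lee_fin.
Qed.

Lemma fine_diam_ge0 x r : 0 < r -> 0 <= fine (diam dist (dball dist x r)).
Proof.
move=> r0; have := dist_le_diam x r x x r0 (dball_self x r r0) (dball_self x r r0).
by rewrite dist_xx.
Qed.

Lemma distp_le x (A : set X) y : A y -> distp dist x A <= dist x y.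
Proof.
move=> Ay; apply: ge_inf; last by exists y.
by exists 0 => _ [z _ <-]; exact: dist_ge0.
Qed.

Lemma le_distp x (A : set X) a t : A a -> (forall y, A y -> t <= dist x y) ->
  t <= distp dist x A.
Proof.
move=> Aa h; apply: lb_le_inf; first by exists (dist x a), a.
by move=> _ [z Az <-]; exact: h.
Qed.

Lemma distp_lt x (A : set X) a t : A a -> distp dist x A < t ->
  exists2 y, A y & dist x y < t.
Proof.
move=> Aa ht; apply: contrapT => hn.
suff : t <= distp dist x A by lra.
apply: (le_distp _ _ a) => // y Ay; rewrite leNgt; apply/negP => yt.
by apply: hn; exists y.
Qed.

Lemma dist_le_distp x c r y : 0 < r -> dball dist c r y ->
  dist x y <= distp dist x (dball dist c r) + fine (diam dist (dball dist c r)).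
Proof.
move=> r0 cy; rewrite -lerBlDr.
apply: (le_distp _ _ y) => // z cz.
have := dist_le_diam c r z y r0 cz cy; have := dist_tri z x y; lra.
Qed.

(* A form of the chain condition without diameters: radii, centres and
   distances to [x] are all comparable to a scale [rho i].  The radius of a
   ball might a priori be much larger than its diameter; this is excluded by
   applying the chain condition at the centre of the ball. *)
Lemma chain_regular (lam : R) (a b : X) :
  chain_condition dist -> 1 <= lam -> 0 < dist a b ->
  exists K : R, exists m : R, [/\ 1 <= K, 0 < m &
    forall (x : X) (eta : R), 0 < eta ->
    exists B D : nat -> X * R, exists rho : nat -> R,
    [/\ forall i, [/\ 0 < rho i, rho i <= eta * powR 2 (- (m * i%:R)) & rho i <= K * rho i.+1],
        forall i, [/\ dist x (B i).1 <= K * rho i, rho i <= K * (B i).2 & (B i).2 <= K * rho i],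
        forall i, [/\ 0 < (D i).2, ballp dist (D i) `<=` ballp dist (B i) `&` ballp dist (B i.+1)
          & ballp dist (B i) `|` ballp dist (B i.+1) `<=` ballp dist (sball K (D i))] &
        forall (y : X) (s : seq nat), uniq s ->
            (forall i, i \in s -> ballp dist (sball lam (B i)) y) -> (size s)%:R <= K]].
Proof.
move=> hch lam1 ab0.
have [M [m [M1 m0 m1 hM]]] := hch lam lam1.
(* Two distinct points bound the diameter of [X] from below, so the real threshold [dist a b / 8]
   replaces one that may be infinite. *)
have dT r : r < dist a b / 8 -> (r%:E < diam dist setT * (8^-1)%:E)%E.
  move=> hr; apply: (@lt_le_trans _ _ ((dist a b / 8)%:E)); first by rewrite lte_fin.
  by rewrite EFinM lee_pmul2r //; exact: le_diam.
(* If [r > 2 * M * dl], apply the chain condition at [c] with a radius [r'] strictly between [dl]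
   and [r / (2 * M)]. The first ball lies outside [B(c, r')] but has a point within [2 * M * r' < r]
   of [c]; that point is in [B(c, r)], hence within [dl < r'] of [c], a contradiction. *)
have unif c r : 0 < r -> fine (diam dist (dball dist c r)) < dist a b / 8 ->
    r <= 2 * M * fine (diam dist (dball dist c r)).
  move=> r0; have := fine_diam_ge0 c r r0.
  set dl := fine _ => dl0 dlt; rewrite leNgt; apply/negP => hlt.
  pose t := Num.min (dist a b / 8) (r / (2 * M)).
  have M20 : 0 < 2 * M by lra.
  have tdl : dl < t by rewrite /t lt_min dlt /= ltr_pdivlMr // mulrC.
  have t1 : t <= dist a b / 8 by rewrite /t ge_min lexx.
  have t2 : t * (2 * M) <= r by rewrite -ler_pdivlMr // /t ge_min lexx orbT.
  pose r' := (dl + t) / 2.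
  have r'dl : dl < r' by rewrite /r'; lra.
  have r't : r' < t by rewrite /r'; lra.
  have r'0 : 0 < r' by lra.
  have r'T : r' < dist a b / 8 by lra.
  have [B [[Bp B0] _ hB _ _]] := hM c r' r'0 (dT _ r'T).
  have := hB 0%N; rewrite mulr0 oppr0 powRr0 mulr1 => hB0.
  have hB0' : distp dist c (ballp dist (B 0%N)) < M * (2 * r') by nra.
  have [y By yl] := distp_lt c _ (B 0%N).1 _ (dball_self _ _ (Bp 0%N)) hB0'.
  have ny := B0 _ By; apply: ny; rewrite /dball /=.
  have yr : dball dist c r y by rewrite /dball /=; nra.
  have := dist_le_diam c r c y r0 (dball_self c r r0) yr; rewrite -/dl; lra.
(* [1 + M] bounds the distance to the centres and the ratio of consecutive scales, [2 * M] the scale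
   by the radius, and [2 * M * M] the radius by the scale. *)
pose K := 1 + M + 2 * M * M.
exists K, m; split=> //; first by rewrite /K; nra.
move=> x eta eta0.
(* The first entry gives [M * r0 <= eta]; the second keeps every diameter of the chain, at most
   [M * M * r0], below the threshold of [unif]. *)
pose r0 := Num.min (eta / M) (dist a b / (16 * M * M)).
have M0 : 0 < M by lra.
have MM0 : 0 < 16 * M * M by nra.
have r00 : 0 < r0 by rewrite /r0 lt_min !divr_gt0.
have r0e : r0 * M <= eta by rewrite -ler_pdivlMr // /r0 ge_min lexx.
have r0T : r0 * (16 * M * M) <= dist a b by rewrite -ler_pdivlMr // /r0 ge_min lexx orbT.
have r0T' : r0 < dist a b / 8.
  have MM1 : 1 <= M * M by nra.
  have : r0 <= r0 * (M * M) by rewrite ler_peMr// ltW.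
  lra.
have [B [[Bp B0] hB2 hB3 hB4 hB5]] := hM x r0 r00 (dT _ r0T').
have [D hD] := choice hB4.
pose rho i := distp dist x (ballp dist (B i)).
pose dm i := fine (diam dist (ballp dist (B i))).
have hb i : M^-1 * dm i <= rho i /\ rho i <= M * dm i.
  have [] := hB2 i; rewrite -/(rho i) -(fineK (diam_dball_fin _ _ (Bp i))) -/(dm i).
  by rewrite -!EFinM !lee_fin.
have hb1 i : dm i <= M * rho i.
  have [h _] := hb i; rewrite -(ler_pM2l (_ : 0 < M^-1)) ?invr_gt0// mulrA mulVf ?gt_eqF//.
  by rewrite mul1r.
have c2 i y : ballp dist (B i) y -> dist x y <= (1 + M) * rho i.
  move=> By; have := dist_le_distp x (B i).1 _ y (Bp i) By; rewrite -/(rho i) -/(dm i).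
  by have := hb1 i; lra.
have step i : rho i <= (1 + M) * rho i.+1.
  have [Dp [Dsub _]] := hD i.
  have [DB DB1] := Dsub _ (dball_self _ _ Dp).
  apply: le_trans (c2 _ _ DB1); exact: distp_le.
have rho0 i : 0 < rho i.
  elim: i => [|i ih].
    apply: lt_le_trans r00 _; apply: (le_distp _ _ (B 0%N).1); first exact: dball_self.
    by move=> y By; rewrite leNgt; apply/negP => yl; have := B0 _ By; apply.
  have := step i; nra.
have pw (i : nat) : powR (2:R) (- (m * i%:R)) <= 1.
  rewrite -[leRHS](powRr0 (2:R)) ler_powR //; first by lra.
  by rewrite oppr_le0 mulr_ge0// ltW.
have dms i : dm i < dist a b / 8.
  have h1 := hb1 i; have h2 : rho i <= M * r0.
    by apply: le_trans (hB3 i) _; rewrite ler_piMr// ltW// mulr_gt0.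
  have : M * rho i <= M * (M * r0) by rewrite ler_pM2l.
  lra.
exists B, D, rho; split.
- move=> i; split=> //.
    apply: le_trans (hB3 i) _; rewrite ler_wpM2r ?powR_ge0//; lra.
  have := step i; have := rho0 i.+1; have : 0 <= M * M * rho i.+1 by rewrite !mulr_ge0// ltW.
  rewrite /K; lra.
- move=> i; split.
  + have := c2 i _ (dball_self _ _ (Bp i)); have := rho0 i; rewrite /K; nra.
  + have [_ h] := hb i; have := fine_diam_le (B i).1 _ (Bp i); rewrite -/(ballp dist (B i)) -/(dm i) => h'.
    have h2 : M * dm i <= M * (2 * (B i).2) by rewrite ler_pM2l.
    have h3 : 0 <= (M - 1) * (M - 1) * (B i).2 by rewrite mulr_ge0 ?mulr_ge0 ?subr_ge0// ltW.
    by have := Bp i; rewrite /K; nra.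
  + have := unif (B i).1 _ (Bp i) (dms i); rewrite -/(dm i) => h.
    have := hb1 i; have := rho0 i; rewrite /K => ? ?.
    have : 2 * M * dm i <= 2 * M * (M * rho i) by rewrite ler_pM2l//; lra.
    nra.
- move=> i; have [Dp [Dsub Dsup]] := hD i; split=> //.
  move=> y /Dsup; rewrite /ballp /sball /dball /= => h.
  apply: lt_le_trans h _; rewrite ler_wpM2r ?ltW// /K; nra.
- move=> y s us hs; apply: le_trans (hB5 y s us hs) _; rewrite /K; nra.
Qed.
End Metric.

Arguments dist_ge0 {R X dist}.
Arguments dist_xx {R X dist}.
Arguments dist_sym {R X dist}.
Arguments dist_tri {R X dist}.
Arguments dball_self {R X dist} hd [x r].
Arguments dball_sub {R X dist} hd [x y r s].
Arguments dball_open {R X dist}.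
Arguments fine_diam_le {R X dist} hd x [r].
Arguments chain_regular {R X dist} hd [lam a b].

(** * Averages and doubling measures *)

Section Average.
Context (R : realType) (d : measure_display) (X : measurableType d).
Variable mu : {measure set X -> \bar R}.

Lemma integrable_cst_fin (D : set X) (c : R) : measurable D -> (mu D < +oo)%E ->
  mu.-integrable D (EFin \o cst c).
Proof.
move=> mD Doo; apply/integrableP; split; first exact/measurable_EFinP.
rewrite (_ : (\int[mu]_(x in D) _)%E = (\int[mu]_(x in D) (cst `|c|%:E) x)%E)//.
by rewrite integral_cst// lte_mul_pinfty// lee_fin.
Qed.

(** Enlarging [A] to [B] in the integral of [|f - c|] costs only the ratio of the masses. With [c]
    the average over [B], this compares averages over nested sets of comparable mass through the
    mean oscillation on the larger one. *)
Lemma avg_sub_le (A B : set X) (f : X -> R) (c L : R) :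
  measurable A -> measurable B -> A `<=` B ->
  (0 < mu A)%E -> (mu B < +oo)%E -> fine (mu B) <= L * fine (mu A) ->
  mu.-integrable B (EFin \o f) ->
  `|avg mu f A - c| <= L * avg mu (fun y => `|f y - c|) B.
Proof.
move=> mA mB AB A0 Boo BLA fB.
have Aoo : (mu A < +oo)%E by apply: le_lt_trans Boo; apply: le_measure; rewrite ?inE.
have fA : mu.-integrable A (EFin \o f) by exact: integrableS fB.
have a0 : 0 < fine (mu A) by rewrite fine_gt0// A0 Aoo.
have cI := integrable_cst_fin.
have b0 : 0 < fine (mu B).
  by rewrite fine_gt0// Boo andbT (lt_le_trans A0)// le_measure ?inE.
have -> : avg mu f A - c = (fine (mu A))^-1 * \int[mu]_(y in A) (f y - c).
  rewrite RintegralB// ?Rintegral_cst//; last exact: cI.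
  by rewrite mulrBr mulrA (mulrC _ c) mulfVK// gt_eqF.
rewrite normrM gtr0_norm ?invr_gt0//.
have iB : mu.-integrable B (EFin \o (fun y => f y - c)) by exact: (integrableB mB fB (cI B c mB Boo)).
have iA : mu.-integrable A (EFin \o (fun y => f y - c)) by exact: integrableS iB.
have h1 := le_normr_Rintegral mA iA.
have h2 : \int[mu]_(t in A) `|f t - c| <= \int[mu]_(t in B) `|f t - c|.
  have inB : mu.-integrable B (EFin \o (fun y => `|f y - c|)) by exact: integrable_norm.
  rewrite /Rintegral fine_le//.
  - apply: integrable_fin_num => //; exact: integrableS inB.
  - exact: integrable_fin_num.
  - by apply: ge0_subset_integral => //; case/integrableP: inB.
rewrite /avg mulrA.
apply: (@le_trans _ _ ((fine (mu A))^-1 * \int[mu]_(t in B) `|f t - c|)).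
  by rewrite ler_pM2l ?invr_gt0//; exact: le_trans h2.
apply: ler_wpM2r; first by apply: Rintegral_ge0.
by rewrite ler_pdivlMr// mulrC ler_pdivrMr.
Qed.

Lemma sume_if_count (I : Type) (s : seq I) (p : pred I) (c : \bar R) : (0 <= c)%E ->
  (\sum_(i <- s) (if p i then c else 0) = (count p s)%:R%:E * c)%E.
Proof.
move=> c0; elim: s => [|i s ih]; first by rewrite big_nil mul0e.
rewrite big_cons ih /=; case: (p i); rewrite ?add0e// natrD EFinD ge0_muleDl ?lee_fin//.
by rewrite mul1e.
Qed.

(** Pointwise, the restrictions of [F] to the [A i] add up to at most [M * F]. With [F = 1] this
    sums masses of balls, with [F = g ^ Q] their [nu]-masses. *)
Lemma overlap_Rintegral (I : eqType) (s : seq I) (A : I -> set X) (B : set X)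
    (F : X -> R) (M : R) :
  (forall i, measurable (A i)) -> measurable B ->
  (forall i, i \in s -> A i `<=` B) ->
  mu.-integrable B (EFin \o F) -> (forall y, 0 <= F y) ->
  (forall y, (count (fun i => y \in A i) s)%:R <= M) ->
  \sum_(i <- s) \int[mu]_(y in A i) F y <= M * \int[mu]_(y in B) F y.
Proof.
move=> mA mB AB iF F0 hM.
have [mF _] := integrableP _ _ _ iF.
have fB : (\int[mu]_(y in B) (F y)%:E)%E \is a fin_num by exact: integrable_fin_num.
have M0 : 0 <= M by apply: le_trans (hM point).
have key : (\sum_(i <- s) \int[mu]_(y in A i) (F y)%:E <= M%:E * \int[mu]_(y in B) (F y)%:E)%E.
  have -> : (\sum_(i <- s) \int[mu]_(y in A i) (F y)%:E =
      \sum_(i <- s) \int[mu]_(y in B) ((EFin \o F) \_ (A i)) y)%E.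
    apply: eq_big_seq => i si; rewrite -integral_mkcondr setIC.
    by have /setIidPl -> := AB _ si.
  have mp i : measurable_fun B ((EFin \o F) \_ (A i)).
    apply/(measurable_restrict _ (mA i) mB); apply: measurable_funS mF => //.
  have p0 i x : (0 <= ((EFin \o F) \_ (A i)) x)%E.
    by rewrite patchE; case: ifP => //= _; rewrite lee_fin.
  rewrite -ge0_integral_sum// -ge0_integralZl_EFin//; last by move=> x _; rewrite lee_fin.
  apply: ge0_le_integral => //.
  - by move=> x _; exact: sume_ge0.
  - exact: emeasurable_sum.
  - by apply: measurable_funeM.
  - move=> y By.
    rewrite (eq_bigr (fun i => if y \in A i then (F y)%:E else 0%E)); last first.
      by move=> i _; rewrite patchE; case: ifP.
    by rewrite sume_if_count ?lee_fin// ler_wpM2r.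
rewrite -lee_fin EFinM [in leRHS]/Rintegral fineK//; apply: le_trans key.
rewrite -sumEFin; rewrite le_eqVlt; apply/orP; left; apply/eqP.
apply: eq_big_seq => i si; rewrite fineK//; apply: integrable_fin_num => //.
by apply: integrableS iF => //; exact: AB.
Qed.

End Average.
Arguments integrable_cst_fin {R d X} mu [D] c.
Arguments avg_sub_le {R d X mu} [A B f c L].
Arguments overlap_Rintegral {R d X mu} [I s A B F M].

Section Doubling.
Context (R : realType) (d : measure_display) (X : measurableType d).
Context (dist : X -> X -> R) (mu : {measure set X -> \bar R}).
Hypothesis hd : is_metric dist.
Hypothesis hopen : forall A, d_open dist A -> measurable A.
Hypothesis hpos : forall x r, 0 < r -> (0 < mu (dball dist x r) < +oo)%E.
Hypothesis hdbl : exists Cmu : R, forall x r, 0 < r ->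
  (mu (dball dist x (2 * r)) <= Cmu%:E * mu (dball dist x r))%E.

Definition mball x r := fine (mu (dball dist x r)).

Lemma dball_measurable x r : measurable (dball dist x r).
Proof. exact/hopen/dball_open. Qed.

Lemma mballE x r : 0 < r -> mu (dball dist x r) = (mball x r)%:E.
Proof.
by move=> /(hpos x) /andP[h0 h]; rewrite /mball fineK// ge0_fin_numE// ltW.
Qed.

Lemma mball_gt0 x r : 0 < r -> 0 < mball x r.
Proof. by move=> r0; have := hpos x r r0; rewrite mballE// lte_fin => /andP[]. Qed.

Lemma mball_le x r y s : 0 < r -> 0 < s -> dball dist x r `<=` dball dist y s ->
  mball x r <= mball y s.
Proof.
move=> r0 s0 h; rewrite -lee_fin -!mballE//.
by apply: le_measure => //; rewrite inE; exact: dball_measurable.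
Qed.

(** The doubling inequality is iterated [n] times, where [K <= 2 ^ n]. Requiring only an inclusion
    of balls lets the centres differ. *)
Lemma mball_dilate (K : R) : exists2 L : R, 1 <= L &
  forall x y r s, 0 < r -> 0 < s -> dball dist x r `<=` dball dist y (K * s) ->
    mball x r <= L * mball y s.
Proof.
have [Cm hCm] := hdbl.
pose C := Num.max 1 Cm.
have C1 : 1 <= C by rewrite /C le_max lexx.
have hC x r : 0 < r -> mball x (2 * r) <= C * mball x r.
  move=> r0; have := hCm x r r0; rewrite !mballE ?mulr_gt0// -EFinM lee_fin => h.
  by apply: le_trans h _; rewrite ler_pM2r ?mball_gt0// /C le_max lexx orbT.
have hn x r n : 0 < r -> mball x (2 ^+ n * r) <= C ^+ n * mball x r.
  move=> r0; elim: n => [|n ih]; first by rewrite !expr0 !mul1r.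
  rewrite !exprS -!mulrA; apply: le_trans (hC _ _ _) _; first by rewrite mulr_gt0// exprn_gt0.
  by rewrite ler_wpM2l// (le_trans _ C1).
have [n Kn] : exists n, K <= 2 ^+ n.
  exists (Num.truncn K).+1; apply: ltW; apply: lt_le_trans (truncnS_gt K) _.
  by rewrite -natrX ler_nat ltnW// ltn_expl.
exists (C ^+ n); first exact: exprn_ege1.
move=> x y r s r0 s0 h; apply: le_trans (hn y s n s0).
apply: mball_le => //; first by rewrite mulr_gt0// exprn_gt0.
apply: (subset_trans h); apply: dball_sub => //.
by rewrite (dist_xx hd) add0r ler_wpM2r// ltW.
Qed.

Lemma separated_overlap (r : R) (s : seq X) : pairwise (fun p q => r <= dist p q) s ->
  forall y, (count (fun p => y \in dball dist p (r / 2)) s)%:R <= (1 : R).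
Proof.
move=> ps y; rewrite -[leRHS]/(1%:R) ler_nat; elim: s ps => [//|p t ih] /= /andP[pt /ih h].
have [yp|] := boolP (y \in _); last by rewrite add0n.
rewrite -[leqRHS]addn0 leq_add2l leqn0 -[_ == _]negbK -lt0n -has_count; apply/negP.
move=> /hasP[q qt yq]; have := allP pt q qt.
move: yp yq; rewrite !inE /dball /= => yp yq.
have := dist_tri hd y p q; rewrite (dist_sym hd y q); lra.
Qed.

(* Every ball [B(p, r/2)], [p] in [s], has a mass comparable with that of
   [B(x, T + r)], which contains all of them, and they are pairwise disjoint. *)
Lemma separated_size (K : R) : exists N : R,
  forall (x : X) (r T : R) (s : seq X), 0 < r -> 0 < T -> T <= K * r ->
    pairwise (fun p q => r <= dist p q) s -> (forall p, p \in s -> dist x p < T) ->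
    (size s)%:R <= N.
Proof.
(* [B(x, T + r)] lies in [B(p, 2 * T + r)], whose radius is at most [(2 * K + 1) * r], that is
   [2 * (K + K + 1)] times [r / 2]. *)
have [L L1 hL] := mball_dilate (2 * (K + K + 1)).
exists L => x r T s r0 T0 TK ps hs.
have r20 : 0 < r / 2 by rewrite divr_gt0.
have TR0 : 0 < T + r by lra.
have disj := separated_overlap r s ps.
have mb p : measurable (dball dist p (r / 2)) by exact: dball_measurable.
have B0oo := hpos x (T + r) TR0.
have hsub p : p \in s -> dball dist p (r / 2) `<=` dball dist x (T + r).
  by move=> /hs xp; apply: dball_sub => //; lra.
have iB : mu.-integrable (dball dist x (T + r)) (EFin \o (fun=> 1)).
  by apply: integrable_cst_fin; [exact: dball_measurable|case/andP: B0oo].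
have := overlap_Rintegral mb (dball_measurable x (T + r)) hsub iB (fun=> ler01) disj.
rewrite mul1r Rintegral_cst; last exact: dball_measurable.
rewrite mul1r -/(mball _ _) => h.
have := mball_gt0 x _ TR0 => xTR.
suff : (size s)%:R * mball x (T + r) <= L * mball x (T + r) by rewrite ler_pM2r.
apply: (@le_trans _ _ (L * \sum_(p <- s) mball p (r / 2))); last first.
  rewrite ler_pM2l; last by lra.
  apply: le_trans h; apply: ler_sum => p _; rewrite Rintegral_cst// mul1r//.
rewrite big_distrr /= -sum1_size natr_sum big_distrl /= !big_seq.
apply: ler_sum => p /hs xp; rewrite mul1r; apply: hL => //.
by apply: dball_sub => //; rewrite (dist_sym hd p x); nra.
Qed.

End Doubling.
Arguments mball {R d X} dist mu.
Arguments dball_measurable {R d X dist} hd hopen.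
Arguments mballE {R d X dist mu} hpos x [r].
Arguments mball_gt0 {R d X dist mu} hpos x [r].
Arguments mball_le {R d X dist mu} hd hopen hpos [x r y s].
Arguments mball_dilate {R d X dist mu} hd hopen hpos hdbl.
Arguments separated_overlap {R d X dist} hd [r s].
Arguments separated_size {R d X dist mu} hd hopen hpos hdbl.


(** Since sizes are bounded, some separated list has the greatest size; a point at distance at least
    [r] from all its members could be added to it. *)
Lemma maximal_separated (R : realType) (X : eqType) (dist : X -> X -> R) (S : set X) (r N : R) :
  (forall s : seq X, pairwise (fun p q => r <= dist p q) s -> (forall p, p \in s -> S p) ->
    (size s)%:R <= N) ->
  exists s : seq X, [/\ pairwise (fun p q => r <= dist p q) s, forall p, p \in s -> S p &
    forall x, S x -> exists2 p, p \in s & dist x p < r].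
Proof.
move=> hN.
pose P (n : nat) := `[< exists s : seq X, [/\ pairwise (fun p q => r <= dist p q) s,
  forall p, p \in s -> S p & size s = n] >].
have exP : exists n, P n by exists 0%N; apply/asboolP; exists [::].
have ubP n : P n -> (n <= Num.truncn N)%N.
  by move=> /asboolP[s [ps sS <-]]; rewrite truncn_ge_nat ?hN// (le_trans _ (hN s ps sS)).
case: (ex_maxnP exP ubP) => n /asboolP[s [ps sS sn]] hmax.
exists s; split=> // x Sx; apply: contrapT => hx.
have : P n.+1.
  apply/asboolP; exists (x :: s); split; last by rewrite /= sn.
  - rewrite /= ps andbT; apply/allP => p pin; rewrite leNgt; apply/negP => h.
    by apply: hx; exists p.
  - by move=> p; rewrite in_cons => /orP[/eqP ->//|/sS].
by move=> /hmax; rewrite ltnn.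
Qed.
Arguments maximal_separated {R X dist} [S r N].

(** * Real series *)

Section RealLemmas.
Context (R : realType).
Implicit Types (a : nat -> R) (Q : R).

(* Replaces Hoelder's inequality in summing [x = (x ^ Q) ^ (1 / Q)]. *)
Lemma le_threshold (x t Q : R) : 0 <= x -> 0 < t -> 1 < Q ->
  x <= t + powR x Q * powR t (1 - Q).
Proof.
move=> x0 t0 Q1; have [xt|tx] := leP x t.
  by rewrite (le_trans xt)// lerDl mulr_ge0// powR_ge0.
have xp : 0 < x by exact: lt_trans tx.
suff : x <= powR x Q * powR t (1 - Q) by move=> h; rewrite (le_trans h)// lerDr ltW.
have -> : powR x Q = x * powR x (Q - 1).
  by rewrite -{2}(powRr1 x0) -powRD ?subrKC// (gt_eqF xp) implybT.
rewrite -mulrA ler_peMr// -[1 - Q]opprB powRN.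
rewrite ler_pdivlMr ?powR_gt0// mul1r ge0_ler_powR// ?nnegrE ?subr_ge0// ltW//.
Qed.

Lemma powR2N_lt1 (b : R) : 0 < b -> powR 2 (- b) < 1.
Proof.
move=> b0; rewrite powRN invf_lt1 ?powR_gt0//.
have := @gt0_ltr_powR _ b b0 1 2; rewrite powR1; apply; rewrite ?nnegrE//.
by rewrite ltr1n.
Qed.

Lemma powR2N_natM (b : R) (k : nat) : powR 2 (- (k%:R * b)) = powR 2 (- b) ^+ k.
Proof. by rewrite -powR_mulrn ?powR_ge0// -powRrM mulNr mulrC. Qed.

Lemma geometric_sum_le (q : R) (n : nat) : 0 <= q -> q < 1 ->
  \sum_(0 <= k < n) q ^+ k <= (1 - q)^-1.
Proof.
move=> q0 q1; have := @geometric_seriesE R 1 q; rewrite lt_eqF// => /(_ isT) /(congr1 (@^~ n)).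
rewrite /series /= (eq_bigr (fun k => q ^+ k)) => [->|k _]; last by rewrite /geometric /= mul1r.
rewrite mul1r ler_piMl ?invr_ge0 ?subr_ge0 ?(ltW q1)//.
by rewrite gerBl exprn_ge0.
Qed.

Lemma nneseries_le_bound (u : nat -> R) (M : R) : (forall i, 0 <= u i) ->
  (forall n, \sum_(0 <= i < n) u i <= M) -> (\sum_(0 <= i <oo) (u i)%:E <= M%:E)%E.
Proof.
move=> u0 hM; apply: lime_le.
  by apply: is_cvg_nneseries => n _ _; rewrite lee_fin.
by apply: nearW => n; rewrite sumEFin lee_fin.
Qed.

(** The [2 ^ k] terms of a block are bounded by [le_threshold] with a common threshold [t]. The
    choice [dl = eps / Q] balances the two parts: the thresholds add up to [2 ^ - (k * dl)], and the
    powers contribute at most [K] times the same quantity. *)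
Lemma block_summable (a : nat -> R) (Q eps K : R) (k0 : nat) : 1 < Q -> 0 < eps ->
  (forall i, 0 <= a i) ->
  (forall k, (k0 <= k)%N -> \sum_(2 ^ k <= i < 2 ^ k.+1) powR (a i) Q <=
     K * powR 2 (- (k%:R * (Q - 1 + eps)))) ->
  cvgn (series a).
Proof.
move=> Q1 e0 a0 hb.
pose dl := eps / Q.
have Q0 : 0 < Q by lra.
have dl0 : 0 < dl by rewrite /dl divr_gt0.
pose q := powR (2:R) (- dl).
have q0 : 0 < q by rewrite powR_gt0.
have q1 : q < 1 by exact: powR2N_lt1.
have K0 : 0 <= K.
  have := hb k0 (leqnn _); have : 0 <= \sum_(2 ^ k0 <= i < 2 ^ k0.+1) powR (a i) Q.
    by apply: sumr_ge0 => i _; rewrite powR_ge0.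
  by move=> /le_trans h /h; rewrite pmulr_lge0// powR_gt0.
have qk k : powR 2 (- (k%:R * dl)) = q ^+ k by exact: powR2N_natM.
have blk k : (k0 <= k)%N -> \sum_(2 ^ k <= i < 2 ^ k.+1) a i <= (1 + K) * q ^+ k.
  move=> kk.
  pose t := powR (2:R) (- (k%:R * (1 + dl))).
  have t0 : 0 < t by rewrite powR_gt0.
  apply: (@le_trans _ _ (\sum_(2 ^ k <= i < 2 ^ k.+1) (t + powR (a i) Q * powR t (1 - Q)))).
    by apply: ler_sum => i _; exact: le_threshold.
  rewrite big_split /= sumr_const_nat -big_distrl /= mulrDl mul1r; apply: lerD.
    rewrite expnS mul2n -addnn addnK -mulr_natl natrX -powR_mulrn ?ler0n//.
    rewrite /t -powRD; last by rewrite pnatr_eq0 implybT.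
    by rewrite -qk mulrDr mulr1 opprD addrA subrr add0r.
  apply: (@le_trans _ _ (K * powR 2 (- (k%:R * (Q - 1 + eps))) * powR t (1 - Q))).
    by rewrite ler_wpM2r ?powR_ge0// hb.
  rewrite -mulrA ler_wpM2l// /t -powRrM -powRD; last by rewrite pnatr_eq0 implybT.
  rewrite -qk le_eqVlt; apply/orP; left; apply/eqP; congr powR.
  by rewrite /dl; field; rewrite gt_eqF.
have nd : nondecreasing_seq (series a).
  by apply/nondecreasing_seqP => n; rewrite /series /= big_nat_recr//= lerDl.
apply: nondecreasing_is_cvgn => //.
pose S0 := series a (2 ^ k0)%N.
exists (S0 + (1 + K) / (1 - q)) => _ [n _ <-].
apply: (@le_trans _ _ (series a (2 ^ (k0 + n))%N)).
  apply: nd; rewrite expnD; apply: leq_trans (ltnW (ltn_expl n (isT : 1 < 2)%N)) _.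
  by rewrite leq_pmull// expn_gt0.
apply: (@le_trans _ _ (S0 + (1 + K) * series (fun k => q ^+ k) n)).
  elim: n => [|n ih]; first by rewrite addn0 [X in _ + _ * X]/series /= big_geq// mulr0 addr0.
  rewrite /series /= addnS.
  rewrite (big_cat_nat _ (n := (2 ^ (k0 + n))%N)) //=; last by rewrite leq_exp2l.
  rewrite (le_trans (lerD ih (blk _ (leq_addr _ _))))//.
  rewrite -addrA lerD2l /series /= big_nat_recr//= mulrDr lerD2l.
  rewrite ler_wpM2l ?addr_ge0// exprD ler_piMl ?exprn_ge0 ?(ltW q0)//.
  by rewrite exprn_ile1// ltW.
rewrite lerD2l ler_wpM2l ?addr_ge0//.
rewrite /series /=; exact: geometric_sum_le (ltW q0) q1.
Qed.

Lemma cvg_of_summable_increments (v a : nat -> R) :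
  (forall i, `|v i.+1 - v i| <= a i) -> cvgn (series a) -> cvgn v.
Proof.
move=> h ca.
have : cvgn (series (telescope v)).
  apply: normed_cvg; apply: series_le_cvg ca => n; first exact: normr_ge0.
    by apply: le_trans (h n).
  by rewrite /telescope /= (le_trans _ (h n)).
move=> c; rewrite (_ : v = cst (v 0%N) + series (telescope v)).
  by apply: is_cvgD => //; exact: is_cvg_cst.
by apply/funext => n; rewrite [LHS](eq_sum_telescope v n).
Qed.

(** Passing from one chain ball to the next costs one term for each of the two balls, hence the sums
    of adjacent terms. *)
Lemma cvg_series_adjacent (W : R) a : cvgn (series a) ->
  cvgn (series (fun i => W * (a i + a i.+1))).
Proof.
move=> /cvg_ex[l cl]; apply/cvg_ex; exists (W * (l + (l - a 0%N))).
rewrite (_ : series _ = fun n => W * (series a n + (series a n.+1 - a 0%N))).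
  apply: cvgM; first exact: cvg_cst.
  apply: cvgD => //; apply: cvgB; last exact: cvg_cst.
  by rewrite (cvg_shiftS (series a)).
apply/funext => n; rewrite /series /= -big_distrr /= big_split /=; congr (_ * (_ + _)).
by rewrite big_nat_recl//= addrAC subrr add0r.
Qed.

(** The rate [m] of the chain is absorbed by shifting the doubly exponential index by a constant [c]
    with [2 ^ c >= 1 / m]. *)
Lemma half_pow_dominates (m : R) (c k : nat) : 0 < m -> 1 <= m * 2 ^+ c ->
  powR 2 (- (m * (2 ^ (c + k))%:R)) <= (2^-1) ^+ (2 ^ k).
Proof.
move=> m0 hc.
rewrite exprVn powRN lef_pV2 ?posrE ?powR_gt0 ?exprn_gt0//.
rewrite -powR_mulrn// ler_powR ?ler1n//.
by rewrite expnD natrM mulrA ler_peMl// natrX.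
Qed.

Lemma powR2_small (b e : R) : 0 < b -> 0 < e ->
  exists k0, forall k, (k0 <= k)%N -> powR 2 (- (k%:R * b)) <= e.
Proof.
move=> b0 e0.
pose q := powR (2:R) (- b).
have q1 : `|q| < 1 by rewrite ger0_norm ?powR_ge0// powR2N_lt1.
have := cvg_expr q1 => /cvgrPdist_le /(_ _ e0)[k0 _ hk].
exists k0 => k kk; have := hk k kk.
by rewrite /= sub0r normrN ger0_norm ?exprn_ge0 ?powR_ge0// powR2N_natM.
Qed.

End RealLemmas.

(** * The exceptional set *)

Section Hausdorff.
Context (R : realType).

Lemma sum_ltn_le (k N : nat) : (\sum_(0 <= n < N) (n < k)%N <= k)%N.
Proof.
suff : (\sum_(0 <= n < N) (n < k)%N <= minn N k)%N by move/leq_trans; apply; exact: geq_minr.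
elim: N => [|N ih]; first by rewrite big_geq.
rewrite big_nat_recr//=; case: ltnP => h.
  by rewrite (minn_idPl h) addn1 ltnS (leq_trans ih)// geq_minl.
by rewrite addn0 (leq_trans ih)// leq_min geq_minr (leq_trans (geq_minr _ _) (leqW h)).
Qed.

Lemma gauge_log_ge0 (Q eps t : R) : 0 <= gauge_log Q eps t.
Proof. by rewrite /gauge_log; case: ifP => // _; exact: powR_ge0. Qed.

(* With [N = 2 ^ l] this bounds the gauge of balls of radius [2 * rho l], whose diameter
   is at most [4 * rho l]. *)
Lemma ln_quarter_exp2 (N : nat) : (4 <= N)%N ->
  N%:R * (ln 2 / 2) <= ln (4^-1 * 2 ^+ N : R).
Proof.
move=> N4.
have ln20 : 0 < ln (2 : R) by rewrite ln_gt0// ltr1n.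
have l4 : ln (4 : R) = 2 * ln 2.
  rewrite (_ : (4 : R) = 2 * 2); last by ring.
  by rewrite lnM ?posrE//; ring.
rewrite lnM ?posrE ?invr_gt0 ?exprn_gt0// lnV ?posrE// l4 lnXn//.
rewrite -[ln 2 *+ N]mulr_natl.
have : 4%:R * ln 2 <= N%:R * ln 2 :> R by rewrite ler_wpM2r ?ler_nat// ltW.
lra.
Qed.

(** For [0 < t] the hypothesis gives [ln (1 / t) >= 2 ^ l * (ln 2 / 2)], and the negative exponent
    reverses this. The bound [2 <= l] makes [2 ^ l >= 4], so the factor 4 costs at most half of the
    logarithm. *)
Lemma gauge_log_le (Q eps : R) : 0 < Q - 1 + eps -> exists2 c : R, 0 <= c &
  forall (l : nat) (t : R), (2 <= l)%N -> t <= 4 * 2^-1 ^+ (2 ^ l) ->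
    gauge_log Q eps t <= c * powR 2 (- (l%:R * (Q - 1 + eps))).
Proof.
set b := Q - 1 + eps => b0.
have ln20 : 0 < ln (2 : R) by rewrite ln_gt0// ltr1n.
exists (powR (ln 2 / 2) (- b)); first exact: powR_ge0.
move=> l t l2 ht; rewrite /gauge_log; case: (leP t 0) => t0; first by rewrite mulr_ge0 ?powR_ge0.
have -> : 1 - Q - eps = - b by rewrite /b; ring.
have -> : powR (ln 2 / 2) (- b) * powR 2 (- (l%:R * b)) = powR (2 ^+ l * (ln 2 / 2)) (- b).
  rewrite [RHS]powRM ?exprn_ge0// ?divr_ge0 ?(ltW ln20)// mulrC; congr (_ * _).
  by rewrite -mulrN powRrM powR_mulrn.
have y0 : 0 < 2 ^+ l * (ln 2 / 2) :> R by rewrite mulr_gt0 ?exprn_gt0// divr_gt0.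
have yt : 2 ^+ l * (ln 2 / 2) <= ln t^-1.
  have tl : 4^-1 * 2 ^+ (2 ^ l) <= t^-1.
    rewrite -[leLHS]invrK lef_pV2 ?posrE ?invr_gt0 ?mulr_gt0 ?invr_gt0 ?exprn_gt0//.
    by rewrite invfM invrK -exprVn.
  have lnt : ln (4^-1 * 2 ^+ (2 ^ l)) <= ln t^-1.
    by rewrite ler_ln ?posrE ?invr_gt0// mulr_gt0 ?invr_gt0 ?exprn_gt0.
  apply: le_trans lnt.
  have -> : 2 ^+ l = (2 ^ l)%N%:R :> R by rewrite natrX.
  by apply: ln_quarter_exp2; rewrite -[4%N]/(2 ^ 2)%N leq_exp2l.
rewrite !powRN lef_pV2 ?posrE ?powR_gt0//; last exact: lt_le_trans yt.
by apply: ge0_ler_powR => //; rewrite ?nnegrE ltW// (lt_le_trans y0).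
Qed.

Context (X : pointedType) (dist : X -> X -> R).
Hypothesis hd : is_metric dist.

Lemma hausdorff_eq0 (h : R -> R) (E : set X) : (forall t, 0 <= h t) ->
  (forall delta eta : R, 0 < delta -> 0 < eta -> exists B : nat -> X * R,
    [/\ forall i, 0 < (B i).2, E `<=` \bigcup_i ballp dist (B i),
        forall i, (diam dist (ballp dist (B i)) <= delta%:E)%E &
        (\sum_(0 <= i <oo) (h (fine (diam dist (ballp dist (B i)))))%:E <= eta%:E)%E]) ->
  hausdorff dist h E = 0%E.
Proof.
move=> h0 hB.
have hdl delta : 0 < delta -> hausdorff_delta dist h delta E = 0%E.
  move=> d0; apply/eqP; rewrite eq_le; apply/andP; split.
    apply/lee_addgt0Pr => eta eta0; rewrite add0e.
    have [B [B1 B2 B3 B4]] := hB delta eta d0 eta0.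
    by apply: le_trans B4; apply: ereal_inf_lbound; exists B.
  apply: le_ereal_inf_tmp => _ [B _ <-].
  by apply: nneseries_ge0 => n _ _; rewrite lee_fin.
rewrite /hausdorff (_ : [set _ | _ in _] = [set 0%E]) ?ereal_sup1//.
apply/seteqP; split=> [_ [dl /hdl -> <-]//|_ ->].
by exists 1 => /=; rewrite ?hdl.
Qed.

(** The Hausdorff content takes a single sequence of balls, so the families of all levels are
    enumerated by a bijection of the naturals with their pairs; nonnegativity permits rearranging
    the double sum. *)
Lemma cover_of_double_cover (h : R -> R) (B2 : nat -> nat -> X * R) (w : nat -> R) (W : R) :
  (forall t, 0 <= h t) ->
  (forall j N, \sum_(0 <= n < N) h (fine (diam dist (ballp dist (B2 j n)))) <= w j) ->
  (forall N, \sum_(0 <= j < N) w j <= W) ->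
  exists e : nat -> nat * nat, (forall p, exists i, e i = p) /\
    (\sum_(0 <= i <oo) (h (fine (diam dist (ballp dist (B2 (e i).1 (e i).2)))))%:E <= W%:E)%E.
Proof.
move=> h0 hw hW.
have /card_set_bijP[e eb] : ([set: nat] #= [set: nat * nat])%card.
  by rewrite card_eq_sym card_nat2.
exists e; split.
  by move=> p; have [_ _ /(_ p I)[i _ <-]] := eb; exists i.
pose f (p : nat * nat) := (h (fine (diam dist (ballp dist (B2 p.1 p.2)))))%:E.
have f0 p : (0 <= f p)%E by rewrite lee_fin.
rewrite (nneseries_esumT (a := fun i => f (e i)))//.
rewrite -(reindex_esum setT setT e f eb).
rewrite (_ : [set: nat * nat] = [set: nat] `*`` (fun=> [set: nat])); last first.
  by apply/seteqP; split.
rewrite -(esum_esum (a := fun i j => f (i, j)))//.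
apply: (@le_trans _ _ (\esum_(j in [set: nat]) (w j)%:E)%E).
  apply: le_esum => j _; rewrite -nneseries_esumT//.
  exact: nneseries_le_bound (hw j).
have w0 j : 0 <= w j by have := hw j 0%N; rewrite big_geq.
rewrite -nneseries_esumT; last by move=> n; rewrite lee_fin.
exact: nneseries_le_bound.
Qed.

Lemma hausdorff_exceptional (Q eps beta V : R) (nu : set X -> R) :
  0 < beta -> beta < Q - 1 + eps ->
  (forall r s, 0 < r -> pairwise (fun p q => 2 * r <= dist p q) s ->
    \sum_(p <- s) nu (dball dist p r) <= V) ->
  hausdorff dist (gauge_log Q eps)
    [set x | forall J, exists2 j, (J <= j)%N &
       powR 2 (- (j%:R * beta)) < nu (dball dist x (2^-1 ^+ (2 ^ j)))] = 0%E.
Proof.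
move=> b0 bb hV; apply: hausdorff_eq0 => [t|dl eta dl0 eta0]; first exact: gauge_log_ge0.
pose rho (j : nat) : R := 2^-1 ^+ (2 ^ j).
have rho0 j : 0 < rho j by rewrite exprn_gt0// invr_gt0.
pose Ej j := [set x | powR 2 (- (j%:R * beta)) < nu (dball dist x (rho j))].
have V0 : 0 <= V by have := hV 1 [::] ltr01 isT; rewrite big_nil.
pose bt := Q - 1 + eps.
have bt0 : 0 < bt by exact: lt_trans bb.
pose q := powR (2:R) (- bt).
pose q' := powR (2:R) (- (bt - beta)).
have q0 : 0 <= q by exact: powR_ge0.
have q1 : q < 1 by exact: powR2N_lt1.
have q'0 : 0 <= q' by exact: powR_ge0.
have q'1 : q' < 1 by apply: powR2N_lt1; rewrite subr_gt0.
have qq' : q <= q' by rewrite /q /q' ler_powR ?ler1n// lerN2 lerBlDr lerDl ltW.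
(* Each centre contributes more than [2 ^ - (j * beta)] to a sum that is at most [V]. *)
have sz j s : pairwise (fun p p' => 2 * rho j <= dist p p') s -> (forall p, p \in s -> Ej j p) ->
    (size s)%:R <= V * powR 2 (j%:R * beta).
  move=> ps sE; rewrite -ler_pdivrMr ?powR_gt0// -powRN.
  apply: le_trans (hV (rho j) s (rho0 j) ps).
  rewrite -sum1_size natr_sum big_distrl /= !big_seq; apply: ler_sum => p /sE.
  by rewrite mul1r => /ltW.
have [s hs] := choice (fun j => maximal_separated (sz j)).
have [c c0 hc] := gauge_log_le Q eps bt0.
have [J1 hJ1] := powR2_small R 1 (dl / 4) ltr01 (divr_gt0 dl0 (ltr0n R 4)).
(* [V] pays for the covering balls of a level and [(1 - q)^-1] for its padding. As [q <= q'], level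
   [J + j] costs at most [W * q' ^ (J + j)] in all. *)
pose W := c * (V + (1 - q)^-1).
have W0 : 0 <= W by rewrite mulr_ge0// addr_ge0// invr_ge0 subr_ge0 ltW.
have e'0 : 0 < eta * (1 - q') / (W + 1) by rewrite divr_gt0 ?mulr_gt0 ?subr_gt0 ?ltr_wpDl.
have bbt : 0 < bt - beta by rewrite subr_gt0.
have [J2 hJ2] := powR2_small R (bt - beta) _ bbt e'0.
(* [2] is required by [gauge_log_le], [J1] keeps the diameters below [dl], and [J2] makes the total
   cost [W * q' ^ J / (1 - q')] at most [eta]. *)
pose J := maxn 2 (maxn J1 J2).
(* A cover is an infinite sequence of balls of positive radius: past the end of [s (J + j)]
   it is padded with balls whose gauges form a geometric series. *)
pose l j n := if (n < size (s (J + j)%N))%N then (J + j)%N else (J + j + n)%N.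
have lJ j n : (J <= l j n)%N by rewrite /l; case: ifP => _; rewrite -?addnA leq_addr.
(* The padding balls are all centred at [point], the default value of [nth]. *)
pose B2 j n : X * R := (nth point (s (J + j)%N) n, 2 * rho (l j n)).
have B20 j n : 0 < (B2 j n).2 by rewrite mulr_gt0.
have diam2 j n : fine (diam dist (ballp dist (B2 j n))) <= 4 * rho (l j n).
  have := fine_diam_le hd (B2 j n).1 (B20 j n); rewrite -/(ballp _ _) => /le_trans; apply.
  by rewrite /= mulrA; lra.
have cost j n : gauge_log Q eps (fine (diam dist (ballp dist (B2 j n)))) <= c * q ^+ l j n.
  rewrite -powR2N_natM; apply: hc => //.
  by apply: leq_trans (lJ j n); rewrite leq_maxl.
pose w j := W * q' ^+ (J + j).
have [] := @cover_of_double_cover (gauge_log Q eps) B2 w eta.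
- exact: gauge_log_ge0.
- move=> j N.
  set k := size (s (J + j)%N).
  apply: (@le_trans _ _ (\sum_(0 <= n < N) (c * q ^+ (J + j) * (n < k)%N%:R + c * q ^+ (J + j) * q ^+ n))).
    apply: ler_sum => n _; apply: (le_trans (cost j n)); rewrite /l -/k; case: ltnP => _.
      by rewrite mulr1 lerDl !mulr_ge0// exprn_ge0.
    by rewrite mulr0 add0r exprD mulrA.
  rewrite big_split /= -!big_distrr /= -natr_sum -mulrDr.
  have k1 : (\sum_(0 <= n < N) (n < k)%N)%:R <= V * powR 2 ((J + j)%:R * beta).
    apply: (@le_trans _ _ k%:R); first by rewrite ler_nat; exact: sum_ltn_le.
    by have [h1 h2 _] := hs (J + j)%N; exact: sz.
  apply: (@le_trans _ _ (c * q ^+ (J + j) * (V * powR 2 ((J + j)%:R * beta) + (1 - q)^-1))).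
    rewrite ler_wpM2l ?mulr_ge0 ?exprn_ge0//; apply: lerD => //; exact: geometric_sum_le.
  rewrite /w /W -!mulrA ler_wpM2l// mulrC mulrDl [leRHS]mulrDl; apply: lerD.
    rewrite -mulrA ler_wpM2l// -!powR2N_natM -powRD; last by rewrite pnatr_eq0 implybT.
    by rewrite le_eqVlt; apply/orP; left; apply/eqP; congr powR; ring.
  rewrite ler_wpM2l ?invr_ge0 ?subr_ge0 ?(ltW q1)//.
  by apply: lerXn2r.
- move=> N; rewrite /w -big_distrr /=.
  rewrite (eq_bigr (fun i => q' ^+ J * q' ^+ i)); last by move=> i _; rewrite exprD.
  rewrite -big_distrr /=.
  have qJ : q' ^+ J <= eta * (1 - q') / (W + 1).
    by rewrite -powR2N_natM hJ2// !leq_max leqnn !orbT.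
  have W1 : 0 < W + 1 by rewrite ltr_wpDl.
  have q'p : 0 < 1 - q' by rewrite subr_gt0.
  apply: (@le_trans _ _ (W * (eta * (1 - q') / (W + 1) * (1 - q')^-1))).
    rewrite ler_wpM2l// ler_pM ?exprn_ge0//; last exact: geometric_sum_le.
    by apply: sumr_ge0 => i _; rewrite exprn_ge0.
  have -> : W * (eta * (1 - q') / (W + 1) * (1 - q')^-1) = eta * (W / (W + 1)).
    by field; rewrite !gt_eqF.
  by rewrite ler_piMr ?(ltW eta0)// ler_pdivrMr// mul1r lerDl.
move=> e [esurj esum]; exists (fun i => B2 (e i).1 (e i).2); split=> //.
- move=> x /(_ J)[j Jj xj].
  have [_ _ /(_ x xj)[p ps xp]] := hs j.
  have [i ei] := esurj ((j - J)%N, index p (s j)).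
  exists i => //; rewrite ei /= /B2 /l subnKC// index_mem ps nth_index//.
  by rewrite /ballp /dball /= (dist_sym hd).
- move=> i; apply: le_trans (diam_dball_le _ _ _ hd _ _) _; rewrite lee_fin /=.
  set L := l _ _.
  have h : rho L <= dl / 4.
    apply: le_trans (hJ1 L _); last first.
      by apply: leq_trans (lJ _ _); rewrite !leq_max leqnn !orbT.
    rewrite powR2N_natM powR_inv1// /rho; apply: ler_wiXn2l.
    - by rewrite invr_ge0.
    - by rewrite invf_le1// ler1n.
    - exact: ltnW (ltn_expl _ _).
  lra.
Qed.

End Hausdorff.
Arguments hausdorff_exceptional {R X dist} hd [Q eps beta V nu].

(** * Consequences of the Poincare inequality *)

Section Poincare.
Context (R : realType) (d : measure_display) (X : measurableType d).
Context (dist : X -> X -> R) (mu : {measure set X -> \bar R}).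
Context (Q : R) (u g : X -> R) (C lam : R).
Hypothesis Q1 : 1 < Q.
Hypothesis hd : is_metric dist.
Hypothesis hopen : forall A, d_open dist A -> measurable A.
Hypothesis hpos : forall x r, 0 < r -> (0 < mu (dball dist x r) < +oo)%E.
Hypothesis hu : forall x r, 0 < r -> mu.-integrable (dball dist x r) (EFin \o u).
Hypothesis mg : measurable_fun setT g.
Hypothesis gQ : (\int[mu]_x (powR (g x) Q)%:E < +oo)%E.
Hypothesis C0 : 0 < C.
Hypothesis lam1 : 1 <= lam.
Hypothesis hP : forall B : X * R, 0 < B.2 ->
  avg mu (fun y => `|u y - avg mu u (ballp dist B)|) (ballp dist B)
  <= C * fine (diam dist (ballp dist B)) *
     powR (avg mu (fun y => powR (g y) Q) (ballp dist (sball lam B))) (Q^-1).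

Definition nu (A : set X) : R := \int[mu]_(y in A) powR (g y) Q.

Definition osc (x : X) (r : R) : R :=
  avg mu (fun y => `|u y - avg mu u (dball dist x r)|) (dball dist x r).

Lemma powR_g_measurable : measurable_fun setT (fun y => powR (g y) Q).
Proof. exact: measurableT_comp (measurable_powR Q) mg. Qed.

Lemma powR_g_integrable (A : set X) : measurable A ->
  mu.-integrable A (EFin \o (fun y => powR (g y) Q)).
Proof.
move=> mA; apply: (@integrableS _ _ _ mu setT) => //.
apply/integrableP; split; first exact/measurable_EFinP/powR_g_measurable.
rewrite (eq_integral (fun x => (powR (g x) Q)%:E))// => x _ /=.
by rewrite ger0_norm// powR_ge0.
Qed.

Lemma nu_ge0 A : 0 <= nu A.
Proof. by apply: Rintegral_ge0 => x _; exact: powR_ge0. Qed.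

Lemma nu_le A B : measurable A -> measurable B -> A `<=` B -> nu A <= nu B.
Proof.
move=> mA mB AB; rewrite /nu /Rintegral fine_le//.
- by apply: integrable_fin_num => //; exact: powR_g_integrable.
- by apply: integrable_fin_num => //; exact: powR_g_integrable.
- apply: ge0_subset_integral => //.
  by apply/measurable_EFinP; apply: measurable_funTS; exact: powR_g_measurable.
  by move=> x _; rewrite lee_fin powR_ge0.
Qed.

Lemma osc_ge0 x r : 0 <= osc x r.
Proof.
by rewrite /osc /avg mulr_ge0 ?invr_ge0 ?fine_ge0//; apply: integral_ge0 => y _; rewrite lee_fin.
Qed.

Lemma osc_poincare x r : 0 < r ->
  osc x r <= C * (2 * r) * powR ((mball dist mu x (lam * r))^-1 * nu (dball dist x (lam * r))) Q^-1.
Proof.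
move=> r0; have := hP (x, r) r0; rewrite /ballp /sball /= -/(osc x r) => h.
apply: le_trans h _; rewrite ler_wpM2r ?powR_ge0// ler_pM2l//.
exact: fine_diam_le.
Qed.

(** Writing [r] as [(r ^ Q) ^ (1 / Q)] brings the factor [r] of the Poincare inequality under the
    root, where the lower mass bound cancels the mass. *)
Lemma osc_le_nu x r c : 0 < r -> powR r Q <= c * mball dist mu x r ->
  osc x r <= 2 * C * powR c Q^-1 * powR (nu (dball dist x (lam * r))) Q^-1.
Proof.
move=> r0 hc; apply: le_trans (osc_poincare _ _ r0) _.
have Q0 : 0 < Q by have := Q1; lra.
have lr0 : 0 < lam * r by rewrite mulr_gt0//; have := lam1; lra.
have m0 := mball_gt0 hpos x r0.
have ml0 := mball_gt0 hpos x lr0.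
have mle : mball dist mu x r <= mball dist mu x (lam * r).
  apply: (mball_le hd hopen hpos) => //; apply: dball_sub => //.
  by rewrite dist_xx// add0r ler_peMl// ltW.
have c0 : 0 <= c.
  by move: (le_trans (powR_ge0 r Q) hc); rewrite pmulr_lge0.
have rE : r = powR (powR r Q) Q^-1 by rewrite -powRrM divff ?gt_eqF// powRr1// ltW.
have -> : C * (2 * r) = 2 * C * r by ring.
rewrite -!mulrA; do 2 (rewrite ler_pM2l//).
rewrite {1}rE -!powRM ?mulr_ge0 ?powR_ge0 ?nu_ge0 ?invr_ge0 ?(ltW ml0)//.
apply: ge0_ler_powR; rewrite ?nnegrE ?invr_ge0 ?mulr_ge0 ?powR_ge0 ?nu_ge0 ?invr_ge0 ?(ltW ml0) ?(ltW Q0)//.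
rewrite mulrA ler_wpM2r ?nu_ge0// ler_pdivrMr// (le_trans hc)// ler_wpM2l//.
Qed.

(** Trades the exponent [1 / Q] for linearity: the Poincare bound becomes additive in mass and [nu]
    and can be summed over a net, while its factor [r] keeps the sum small. *)
Lemma powR_inv_le1D (t : R) : 0 <= t -> powR t Q^-1 <= 1 + t.
Proof.
move=> t0; have Qi0 : 0 < Q^-1 by rewrite invr_gt0; have := Q1; lra.
have Qi1 : Q^-1 <= 1 by rewrite invf_le1//; have := Q1; lra.
have [t1|t1] := leP t 1.
  apply: (@le_trans _ _ 1); last by rewrite lerDl.
  by rewrite (_ : 1 = powR 1 Q^-1); [apply: ge0_ler_powR; rewrite ?nnegrE// ltW|by rewrite powR1].
apply: (@le_trans _ _ t); last by rewrite lerDr.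
by rewrite -[leRHS](powRr1 t0); apply: ler_powR => //; exact: ltW.
Qed.

Lemma osc_mass_le x r : 0 < r -> osc x r * mball dist mu x r <=
  2 * C * r * (mball dist mu x (lam * r) + nu (dball dist x (lam * r))).
Proof.
move=> r0.
have lr0 : 0 < lam * r by rewrite mulr_gt0//; have := lam1; lra.
have m0 := mball_gt0 hpos x r0.
have ml0 := mball_gt0 hpos x lr0.
have mle : mball dist mu x r <= mball dist mu x (lam * r).
  apply: (mball_le hd hopen hpos) => //; apply: dball_sub => //.
  by rewrite dist_xx// add0r ler_peMl// ltW.
set m := mball dist mu x (lam * r) in ml0 mle *.
set v := nu _.
have v0 : 0 <= v by exact: nu_ge0.
have t0 : 0 <= m^-1 * v by rewrite mulr_ge0 ?invr_ge0// ltW.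
have o1 : osc x r <= 2 * C * r * (1 + m^-1 * v).
  apply: le_trans (osc_poincare _ _ r0) _.
  have -> : C * (2 * r) = 2 * C * r by ring.
  by rewrite ler_pM2l ?mulr_gt0//; exact: powR_inv_le1D.
have k0 : 0 <= 2 * C * r * (1 + m^-1 * v) by rewrite !mulr_ge0 ?addr_ge0// ltW.
have -> : 2 * C * r * (m + v) = 2 * C * r * (1 + m^-1 * v) * m.
  by field; rewrite gt_eqF.
apply: ler_pM => //; last exact: ltW.
exact: osc_ge0.
Qed.

Lemma avg_ball_diff x r y s L : 0 < r -> 0 < s -> dball dist y s `<=` dball dist x r ->
  mball dist mu x r <= L * mball dist mu y s ->
  `|avg mu u (dball dist y s) - avg mu u (dball dist x r)| <= L * osc x r.
Proof.
move=> r0 s0 sub hL; apply: avg_sub_le => //.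
- exact: dball_measurable.
- exact: dball_measurable.
- by case/andP: (hpos y s s0).
- by case/andP: (hpos x r r0).
- exact: hu.
Qed.


(** * Convergence of averages outside the exceptional set *)

Hypothesis hdbl : exists Cmu : R, forall x r, 0 < r ->
  (mu (dball dist x (2 * r)) <= Cmu%:E * mu (dball dist x r))%E.
Hypothesis hQ : exists C0 : R, 1 <= C0 /\ forall (a x : X) (r s : R),
  dball dist a r x -> 0 < s -> s <= r ->
  powR (s / r) Q <= C0 * fine (mu (dball dist x s)) / fine (mu (dball dist a r)).
Hypothesis hchain : chain_condition dist.

(** This is the [Q]-doubling condition relative to the fixed ball [B(x, 1)], whose mass is absorbed
    in [c]; one constant thus serves all small balls near [x]. *)
Lemma lower_mass (x : X) : exists2 c : R, 0 <= c &
  forall y s, dist x y < 1 -> 0 < s -> s <= 1 -> powR s Q <= c * mball dist mu y s.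
Proof.
have [K [K1 hK]] := hQ; exists (K / mball dist mu x 1).
  by rewrite divr_ge0// ltW ?mball_gt0//; lra.
move=> y s xy s0 s1; have := hK x y 1 s xy s0 s1; rewrite divr1 => h.
by rewrite mulrAC.
Qed.

(** The chain condition states bounded overlap for duplicate-free lists of indices. Filtering [s] by
    membership of [y] turns this into the count needed for summing integrals. *)
Lemma nu_overlap (M : R) (s : seq nat) (B : nat -> set X) (A : set X) :
  (forall i, measurable (B i)) -> measurable A -> (forall i, i \in s -> B i `<=` A) ->
  uniq s ->
  (forall (y : X) (t : seq nat), uniq t -> (forall i, i \in t -> B i y) -> (size t)%:R <= M) ->
  \sum_(i <- s) nu (B i) <= M * nu A.
Proof.
move=> mB mA BA us hM; apply: overlap_Rintegral => //.
- exact: powR_g_integrable.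
- by move=> y; exact: powR_ge0.
- move=> y; rewrite -size_filter; apply: (hM y); first exact: filter_uniq.
  by move=> i; rewrite mem_filter => /andP[/set_mem].
Qed.

Lemma chain_avg_cvg (x : X) (beta : R) (k0 : nat) (K m c : R)
    (B D : nat -> X * R) (rho : nat -> R) :
  Q - 1 < beta -> 1 <= K -> 0 < m ->
  (forall j, (k0 <= j)%N -> nu (dball dist x (2^-1 ^+ (2 ^ j))) <= powR 2 (- (j%:R * beta))) ->
  (forall i, 0 < (B i).2 /\ powR (B i).2 Q <= c * mball dist mu (B i).1 (B i).2) ->
  (forall i, dball dist (B i).1 (lam * (B i).2) `<=` dball dist x (powR 2 (- (m * i%:R)))) ->
  (forall i, [/\ 0 < (D i).2, ballp dist (D i) `<=` ballp dist (B i) `&` ballp dist (B i.+1)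
          & ballp dist (B i) `|` ballp dist (B i.+1) `<=` ballp dist (sball K (D i))]) ->
  (forall (y : X) (s : seq nat), uniq s ->
     (forall i, i \in s -> ballp dist (sball lam (B i)) y) -> (size s)%:R <= K) ->
  cvgn (fun i => avg mu u (ballp dist (B i))).
Proof.
move=> hb K1 m0 hnu hmass hsub hD hov.
pose a i := powR (nu (dball dist (B i).1 (lam * (B i).2))) Q^-1.
have a0 i : 0 <= a i by exact: powR_ge0.
have Q0 : 0 < Q by have := Q1; lra.
have aQ i : powR (a i) Q = nu (dball dist (B i).1 (lam * (B i).2)).
  by rewrite /a -powRrM mulVf ?gt_eqF// powRr1// nu_ge0.
have mb x0 r0 : measurable (dball dist x0 r0) by exact: dball_measurable.
pose e := beta - (Q - 1).
have e0 : 0 < e by rewrite /e subr_gt0.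
have [c1 hc1] : exists c1 : nat, 1 <= m * 2 ^+ c1.
  exists (Num.truncn m^-1).+1; rewrite mulrC -ler_pdivrMr// div1r.
  apply: ltW; apply: lt_le_trans (truncnS_gt m^-1) _.
  by rewrite -natrX ler_nat ltnW// ltn_expl.
have ca : cvgn (series a).
  (* The factor [2 ^ (c1 * beta)] pays for replacing the index [k] by [k - c1], and starting at
     [c1 + k0] keeps [k - c1 >= k0]. *)
  apply: (@block_summable R a Q e (K * powR 2 (c1%:R * beta)) (c1 + k0)%N) => // k kk.
  have kc : (k0 <= k - c1)%N by rewrite leq_subRL// (leq_trans _ kk)// leq_addr.
  rewrite (eq_bigr _ (fun i _ => aQ i)).
  pose A := dball dist x (powR 2 (- (m * (2 ^ k)%:R))).
  have h1 : \sum_(2 ^ k <= i < 2 ^ k.+1) nu (dball dist (B i).1 (lam * (B i).2)) <= K * nu A.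
    apply: (nu_overlap _ _ (fun i => dball dist (B i).1 (lam * (B i).2))) => //.
    - exact: mb.
    - move=> i; rewrite mem_index_iota => /andP[ki _].
      apply: subset_trans (hsub i) _; apply: dball_sub => //.
      rewrite (dist_xx hd) add0r ler_powR ?ler1n// lerN2 ler_pM2l// ler_nat//.
    - exact: iota_uniq.
  apply: (le_trans h1); rewrite -mulrA ler_pM2l; last by lra.
  rewrite -powRD; last by rewrite pnatr_eq0 implybT.
  have -> : c1%:R * beta + - (k%:R * (Q - 1 + e)) = - ((k - c1)%:R * beta).
    rewrite natrB; last by rewrite (leq_trans _ kk)// leq_addr.
    by rewrite /e; ring.
  apply: le_trans (hnu _ kc); apply: nu_le; [exact: mb|exact: mb|].
  apply: dball_sub => //; rewrite (dist_xx hd) add0r.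
  have := @half_pow_dominates R m c1 (k - c1)%N m0 hc1.
  by rewrite subnKC// (leq_trans _ kk)// leq_addr.
have [L L1 hL] := mball_dilate hd hopen hpos hdbl K.
pose W := L * (2 * C * powR c Q^-1).
apply: (@cvg_of_summable_increments R _ (fun i => W * (a i + a i.+1))).
  move=> i; have [Dp Dsub Dsup] := hD i.
  have o j : osc (B j).1 (B j).2 <= 2 * C * powR c Q^-1 * a j.
    by have [Bp Bm] := hmass j; exact: osc_le_nu.
  (* [D i] lies in both consecutive balls, and its dilation by [K] contains both, so its average is
     close to each of theirs. *)
  have h j : (j = i \/ j = i.+1) -> `|avg mu u (ballp dist (D i)) - avg mu u (ballp dist (B j))| <= W * a j.
    move=> hj; have [Bp Bm] := hmass j.
    have s1 : dball dist (D i).1 (D i).2 `<=` dball dist (B j).1 (B j).2.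
      by move=> y /Dsub[y1 y2]; case: hj => ->.
    have s2 : dball dist (B j).1 (B j).2 `<=` dball dist (D i).1 (K * (D i).2).
      by move=> y yB; apply: Dsup; case: hj yB => -> yB; [left|right].
    have := avg_ball_diff (B j).1 _ (D i).1 _ L Bp Dp s1 (hL _ _ _ _ Bp Dp s2).
    move=> /le_trans; apply; rewrite /W -mulrA ler_pM2l//; lra.
  have h1 := h i (or_introl erefl); have h2 := h i.+1 (or_intror erefl).
  rewrite mulrDr; apply: le_trans (lerD h1 h2).
  rewrite -[X in `|X|](subrKA (avg mu u (ballp dist (D i)))).
  by apply: le_trans (ler_normD _ _) _; rewrite addrC lerD2l distrC.
exact: cvg_series_adjacent.
Qed.


(** For small [s], both [B(x, s)] and a chain ball of scale comparable to [s] lie in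
    [B(x, 2 * K * s)] and have comparable mass, so their averages differ by a multiple of the
    oscillation there, which tends to 0. *)
Lemma avg_cvg (x : X) (beta : R) (k0 : nat) : Q - 1 < beta ->
  (forall j, (k0 <= j)%N -> nu (dball dist x (2^-1 ^+ (2 ^ j))) <= powR 2 (- (j%:R * beta))) ->
  exists l : R, avg mu u (dball dist x r) @[r --> 0^'+] --> l.
Proof.
move=> hb hnu.
(* In a one-point space all balls of positive radius coincide; otherwise a second point gives access
   to [chain_regular]. *)
have [[y xy]|single] := pselect (exists y, 0 < dist x y); last first.
  exists (avg mu u (dball dist x 1)); apply: cvg_near_cst.
  near=> r; rewrite (_ : dball dist x r = dball dist x 1)//.
  have z y : dist x y = 0.
    apply/eqP; rewrite eq_le (dist_ge0 hd) andbT leNgt; apply/negP => h.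
    by apply: single; exists y.
  have r0 : 0 < r by near: r; exact: nbhs_right_gt.
  by apply/seteqP; split=> y _; rewrite /dball /= z.
have [K [m [K1 m0 hreg]]] := chain_regular hd hchain lam1 xy.
have K0 : 0 < K by lra.
have l1 : 0 < 1 + lam by have := lam1; lra.
have [c c0 hc] := lower_mass x.
(* With this [eta] the dilated ball [lam B_i] lies in [B(x, 2 ^ - (m * i))], and [K * rho i < 1]
   makes [lower_mass] applicable to every [B_i]. *)
pose eta := ((1 + lam) * K)^-1.
have eta0 : 0 < eta by rewrite invr_gt0 mulr_gt0.
have [B [D [rho [hrho hB hD hov]]]] := hreg x eta eta0.
have etaK : (1 + lam) * (K * eta) = 1 by rewrite mulrA divff// gt_eqF// mulr_gt0.
have etaK1 : K * eta < 1.
  have : 0 < lam * (K * eta) by rewrite mulr_gt0 ?mulr_gt0//; have := lam1; lra.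
  lra.
have pw (i : nat) : powR (2:R) (- (m * i%:R)) <= 1.
  rewrite -[leRHS](powRr0 (2:R)) ler_powR ?ler1n//.
  by rewrite oppr_le0 mulr_ge0// ltW.
have Krho i : K * rho i <= K * eta * powR 2 (- (m * i%:R)).
  by have [_ h _] := hrho i; rewrite -mulrA ler_pM2l.
have Krho1 i : K * rho i < 1.
  apply: le_lt_trans (Krho i) _; apply: le_lt_trans etaK1.
  by rewrite ler_piMr// ltW// mulr_gt0.
have Bp i : 0 < (B i).2.
  have [r0 _ _] := hrho i; have [_ h _] := hB i.
  by have := lt_le_trans r0 h; rewrite pmulr_rgt0.
have hmass i : 0 < (B i).2 /\ powR (B i).2 Q <= c * mball dist mu (B i).1 (B i).2.
  split=> //; have [h1 h2 h3] := hB i; apply: hc => //.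
    exact: le_lt_trans h1 (Krho1 i).
  by apply: ltW; exact: le_lt_trans h3 (Krho1 i).
have hsub i : dball dist (B i).1 (lam * (B i).2) `<=` dball dist x (powR 2 (- (m * i%:R))).
  apply: dball_sub => //; have [h1 h2 h3] := hB i.
  apply: (@le_trans _ _ ((1 + lam) * (K * rho i))).
    by rewrite mulrDl mul1r; apply: lerD => //; rewrite ler_pM2l//; have := lam1; lra.
  rewrite -[leRHS]mul1r -[X in _ <= X * _]etaK -[leRHS]mulrA ler_pM2l//; exact: Krho.
have cv := chain_avg_cvg x beta k0 K m c B D rho hb K1 m0 hnu hmass hsub hD hov.
pose l := limn (fun i => avg mu u (ballp dist (B i))).
exists l; apply/cvgrPdist_le => e e0.
have {}cv : (fun i => avg mu u (ballp dist (B i))) @ \oo --> l by [].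
have [N _ hN] := (@cvgrPdist_le _ _ _ _ _ _ _).1 cv (e / 2) (divr_gt0 e0 (ltr0n _ 2)).
(* [2 * K] serves the comparison with [B(x, s)]. The other two terms serve [B_i]: they bound its
   distance to [x] and the radius [2 * K * s] in units of its own radius. *)
have [L L1 hL] := mball_dilate hd hopen hpos hdbl (K * K + 2 * K * K * K + 2 * K).
pose W := 2 * L * (2 * C * powR c Q^-1).
have Q0 : 0 < Q by have := Q1; lra.
have P0 : 0 <= 2 * C * powR c Q^-1 by rewrite !mulr_ge0 ?powR_ge0// ltW.
have W0 : 0 <= W by rewrite !mulr_ge0 ?powR_ge0//; have := C0; lra.
have W1 : 0 < W + 1 by rewrite ltr_wpDl.
have bQ0 : 0 < beta / Q by rewrite divr_gt0//; have := Q1; lra.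
have eW0 : 0 < e / 2 / (W + 1) by rewrite !divr_gt0.
have [j0 hj0] := powR2_small R (beta / Q) _ bQ0 eW0.
pose j := maxn j0 k0.
pose t : R := 2^-1 ^+ (2 ^ j).
have t0 : 0 < t by rewrite exprn_gt0// invr_gt0.
have t1 : t <= 1 by rewrite exprn_ile1// ?invr_ge0// invf_le1// ler1n.
have nut : powR (nu (dball dist x t)) Q^-1 <= e / 2 / (W + 1).
  apply: le_trans (hj0 j (leq_maxl _ _)).
  rewrite mulrA -mulNr powRrM; apply: ge0_ler_powR; rewrite ?nnegrE ?nu_ge0 ?powR_ge0 ?invr_ge0 ?(ltW Q0)//.
  exact: hnu (leq_maxr _ _).
have lK0 : 0 < lam * (2 * K) by rewrite !mulr_gt0//; have := lam1; lra.
near=> s.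
have s0 : 0 < s by near: s; exact: nbhs_right_gt.
have srho : s < rho N by near: s; apply: nbhs_right_lt; case: (hrho N).
have st : s * (lam * (2 * K)) < t.
  by rewrite -ltr_pdivlMr//; near: s; apply: nbhs_right_lt; rewrite divr_gt0.
(* Take the least [i >= N] with [rho i <= s]. As [s < rho N], it exceeds [N], so
   [s < rho (i - 1) <= K * rho i]. *)
have [i [Ni rs sr]] : exists i, [/\ (N <= i)%N, rho i <= s & s <= K * rho i].
  have ex : exists i, (N <= i)%N && (rho i <= s).
    have [i0 hi0] := powR2_small R m (s / eta) m0 (divr_gt0 s0 eta0).
    exists (maxn i0 N); rewrite leq_maxr /=.
    have [_ h _] := hrho (maxn i0 N); apply: (le_trans h).
    by rewrite mulrC -ler_pdivlMr// mulrC hi0// leq_maxl.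
  case: (ex_minnP ex) => i /andP[Ni rs] hmin; exists i; split=> //.
  case: i Ni rs hmin => [|i] Ni rs hmin.
    by move: Ni rs srho; rewrite leqn0 => /eqP -> /le_lt_trans h /h; rewrite ltxx.
  have [Ni'|iN] := leqP N i.
    have [_ _] := hrho i; apply: le_trans; apply: ltW; rewrite ltNge; apply/negP => h.
    by have := hmin i; rewrite Ni' h => /(_ isT); rewrite ltnn.
  have E : i.+1 = N by apply/eqP; rewrite eqn_leq iN Ni.
  by move: rs srho; rewrite E => /le_lt_trans h /h; rewrite ltxx.
have [h1 h2 h3] := hB i; have [r0 _ _] := hrho i; have [Bpi Bm] := hmass i.
have Ks0 : 0 < 2 * K * s by rewrite !mulr_gt0.
have lKs : lam * (2 * K * s) < t by rewrite (_ : lam * _ = s * (lam * (2 * K))) //; ring.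
have Ks1 : 2 * K * s <= 1.
  apply: le_trans t1; apply: le_trans (ltW lKs); rewrite ler_peMl// ltW//.
have Krs : K * rho i <= K * s by rewrite ler_pM2l.
have sB : s <= K * K * (B i).2.
  by apply: (le_trans sr); rewrite -mulrA ler_pM2l.
have Ksle : s <= K * s by rewrite ler_peMl// ltW.
have KKB : K * rho i <= K * K * (B i).2 by rewrite -mulrA ler_pM2l.
have KsB : 2 * K * s <= 2 * K * K * K * (B i).2.
  have := ler_wpM2l (ltW (mulr_gt0 (ltr0n R 2) K0)) sB; lra.
have oB : osc x (2 * K * s) <= 2 * C * powR c Q^-1 * powR (nu (dball dist x t)) Q^-1.
  apply: le_trans (osc_le_nu _ _ c Ks0 _) _.
    by apply: hc => //; rewrite (dist_xx hd).
  apply: (ler_wpM2l P0).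
  apply: ge0_ler_powR; rewrite ?nnegrE ?nu_ge0 ?invr_ge0 ?(ltW Q0)//.
  apply: nu_le; [exact: dball_measurable|exact: dball_measurable|].
  by apply: dball_sub => //; rewrite (dist_xx hd) add0r ltW.
have d1 : `|avg mu u (dball dist x s) - avg mu u (dball dist x (2 * K * s))| <= L * osc x (2 * K * s).
  apply: avg_ball_diff => //.
    by apply: dball_sub => //; rewrite (dist_xx hd) add0r; lra.
  apply: hL => //; apply: dball_sub => //; rewrite (dist_xx hd) add0r ler_pM2r//.
  have : 0 <= K * K by rewrite mulr_ge0// ltW.
  have : 0 <= 2 * K * K * K by rewrite !mulr_ge0// ltW.
  lra.
have d2 : `|avg mu u (ballp dist (B i)) - avg mu u (dball dist x (2 * K * s))| <= L * osc x (2 * K * s).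
  apply: avg_ball_diff => //.
    by apply: dball_sub => //; lra.
  apply: hL => //; apply: dball_sub => //; rewrite (dist_sym hd).
  have : 0 <= K * (B i).2 by rewrite mulr_ge0// ltW.
  lra.
have d3 := hN i Ni; rewrite /= in d3.
have d4 : 2 * (L * osc x (2 * K * s)) <= e / 2.
  apply: (@le_trans _ _ (W * powR (nu (dball dist x t)) Q^-1)).
    rewrite (_ : W * _ = 2 * (L * (2 * C * powR c Q^-1 * powR (nu (dball dist x t)) Q^-1))).
      by rewrite ler_wpM2l// ler_wpM2l// (le_trans ler01 L1).
    by rewrite /W !mulrA.
  apply: (@le_trans _ _ (W * (e / 2 / (W + 1)))); first by rewrite ler_wpM2l.
  rewrite mulrCA ler_piMr//; first by rewrite divr_ge0// ltW.
  by rewrite ler_pdivrMr// mul1r lerDl.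
set A1 := avg _ _ (dball dist x s) in d1 *.
set A2 := avg _ _ (dball dist x (2 * K * s)) in d1 d2 *.
set A3 := avg _ _ (ballp dist (B i)) in d2 d3 *.
clear - d1 d2 d3 d4; move: d1 d2 d3; rewrite !ler_norml => /andP[? ?] /andP[? ?] /andP[? ?].
by apply/andP; split; lra.
Unshelve. all: end_near.
Qed.


(** * Nets and almost everywhere convergence of averages *)

(** The centres whose dilated balls contain [y] form an [r]-separated list within [2 * lam * r] of
    [y], so [separated_size] bounds their number independently of [r]. *)
Lemma overlap_dilated : exists2 N : R, 0 <= N & forall (r : R) (s : seq X), 0 < r ->
  pairwise (fun p q => r <= dist p q) s ->
  forall y, (count (fun p => y \in dball dist p (lam * (2 * r))) s)%:R <= N.
Proof.
have [N hN] := separated_size hd hopen hpos hdbl (lam * 2).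
have h r (s : seq X) : 0 < r -> pairwise (fun p q => r <= dist p q) s ->
  forall y, (count (fun p => y \in dball dist p (lam * (2 * r))) s)%:R <= N.
  move=> r0 ps y; rewrite -size_filter.
  apply: (hN y r (lam * (2 * r))) => //.
  - by rewrite !mulr_gt0//; have := lam1; lra.
  - by rewrite mulrA.
  - exact: pairwise_filter.
  - by move=> p; rewrite mem_filter => /andP[/set_mem]; rewrite /dball /= (dist_sym hd).
by exists N => //; apply: le_trans (h 1 [::] ltr01 isT point).
Qed.

(** [osc_mass_le] is summed over the net, using bounded overlap for both mass and [nu]. As [r <= 1],
    all dilated balls lie in [B(x, T + 2 * lam)]. *)
Lemma net_osc_sum : exists2 N : R, 0 <= N & forall (x : X) (T r : R) (s : seq X),
  0 < T -> 0 < r -> r <= 1 -> pairwise (fun p q => r <= dist p q) s ->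
  (forall p, p \in s -> dist x p < T) ->
  \sum_(p <- s) osc p (2 * r) * mball dist mu p (2 * r) <=
  4 * C * r * (N * (mball dist mu x (T + 2 * lam) + nu (dball dist x (T + 2 * lam)))).
Proof.
have [N N0 hN] := overlap_dilated.
exists N => // x T r s T0 r0 r1 ps hs.
have r20 : 0 < 2 * r by rewrite mulr_gt0.
apply: (@le_trans _ _ (\sum_(p <- s) 4 * C * r *
    (mball dist mu p (lam * (2 * r)) + nu (dball dist p (lam * (2 * r)))))).
  apply: ler_sum => p _; rewrite (_ : 4 * C * r = 2 * C * (2 * r)); last by ring.
  exact: osc_mass_le.
have Tl : 0 < T + 2 * lam by have := lam1; lra.
have mb y t : measurable (dball dist y t) by exact: dball_measurable.
have sub p : p \in s -> dball dist p (lam * (2 * r)) `<=` dball dist x (T + 2 * lam).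
  move=> /hs xp; apply: dball_sub => //.
  have : lam * r <= lam * 1 by rewrite ler_wpM2l// (le_trans ler01 lam1).
  lra.
have fin : (mu (dball dist x (T + 2 * lam)) < +oo)%E by case/andP: (hpos x _ Tl).
rewrite -big_distrr /= big_split /= ler_pM2l ?mulr_gt0// mulrDr; apply: lerD.
  have := overlap_Rintegral (fun p => mb p (lam * (2 * r))) (mb x (T + 2 * lam)) sub
    (integrable_cst_fin mu 1 (mb x _) fin) (fun=> ler01) (hN r s r0 ps).
  rewrite Rintegral_cst// mul1r; apply: le_trans.
  by apply: ler_sum => p _; rewrite Rintegral_cst// mul1r.
by apply: overlap_Rintegral => //; [exact: powR_g_integrable|move=> y; exact: powR_ge0|exact: hN].
Qed.

(** Both summands have integral [osc p r * mball dist mu p r]. Adding the constant [osc p r] lets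
    one pointwise quantity control both the deviation of [u] and the oscillation. *)
Lemma integral_osc_ball p r : 0 < r ->
  mu.-integrable (dball dist p r) (EFin \o (fun y => `|u y - avg mu u (dball dist p r)| + osc p r)) /\
  (\int[mu]_(y in dball dist p r) (`|u y - avg mu u (dball dist p r)| + osc p r)%:E =
   (2 * (osc p r * mball dist mu p r))%:E)%E.
Proof.
move=> r0; have mB : measurable (dball dist p r) by exact: dball_measurable.
have fin : (mu (dball dist p r) < +oo)%E by case/andP: (hpos p r r0).
have i1 : mu.-integrable (dball dist p r) (EFin \o (fun y => u y - avg mu u (dball dist p r))).
  exact: (integrableB mB (hu p r r0) (integrable_cst_fin mu _ mB fin)).
have i2 : mu.-integrable (dball dist p r) (EFin \o (fun y => `|u y - avg mu u (dball dist p r)|)).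
  exact: integrable_norm.
have i3 := integrable_cst_fin mu (osc p r) mB fin.
have i4 : mu.-integrable (dball dist p r)
    (EFin \o (fun y => `|u y - avg mu u (dball dist p r)| + osc p r)).
  exact: (integrableD mB i2 i3).
split=> //; rewrite -[LHS]fineK; last exact: integrable_fin_num.
have := RintegralD mB i2 i3; rewrite /Rintegral => ->; congr EFin.
rewrite -[X in _ + X]/(\int[mu]_(y in dball dist p r) osc p r) Rintegral_cst//.
have m0 := mball_gt0 hpos p r0.
rewrite mulr_natl mulr2n -/(mball _ _ _ _); congr (_ + _).
by rewrite /osc /avg -/(mball dist mu p r) mulrAC mulVf ?mul1r// gt_eqF.
Qed.

Lemma avg_cvg_ae : exists r : nat -> R, [/\ forall n, 0 < r n, r @ \oo --> (0 : R) &
  {ae mu, forall x, avg mu u (dball dist x (r n)) @[n --> \oo] --> u x}].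
Proof.
have [N N0 hN] := net_osc_sum.
have lam0 : 0 < lam by exact: lt_le_trans lam1.
pose T (n : nat) : R := n.+1%:R.
pose A n := 4 * C * (N * (mball dist mu point (T n + 2 * lam) + nu (dball dist point (T n + 2 * lam)))).
have A0 n : 0 <= A n.
  by rewrite /A !mulr_ge0 ?addr_ge0 ?nu_ge0 ?(ltW C0)// ltW// mball_gt0// addr_gt0 ?mulr_gt0 ?ltr0n.
(* [A n * r n] bounds the oscillations over an [r n]-net of the ball of radius [n + 1]. *)
pose r n : R := 2^-1 ^+ n / (A n + 1).
have A1 n : 0 < A n + 1 by rewrite ltr_wpDl.
have r0 n : 0 < r n by rewrite divr_gt0// exprn_gt0// invr_gt0.
have h1 : (2^-1 : R) < 1 by rewrite invf_lt1// ltr1n.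
have r2n n : r n <= 2^-1 ^+ n.
  by rewrite /r ler_pdivrMr// ler_peMr ?exprn_ge0 ?invr_ge0// lerDr.
have r1 n : r n <= 1 by rewrite (le_trans (r2n n))// exprn_ile1 ?invr_ge0// ltW.
have rA n : A n * r n <= 2^-1 ^+ n.
  rewrite /r mulrCA ler_piMr ?exprn_ge0 ?invr_ge0//.
  by rewrite ler_pdivrMr// mul1r lerDl.
have net n : exists s : seq X, [/\ pairwise (fun p q => r n <= dist p q) s,
    forall p, p \in s -> dball dist point (T n) p &
    forall x, dball dist point (T n) x -> exists2 p, p \in s & dist x p < r n].
  have [M hM] := separated_size hd hopen hpos hdbl (T n / r n).
  apply: (@maximal_separated _ _ _ _ _ M) => s ps hs.
  by apply: (hM point (r n) (T n)) => //; rewrite ?ltr0n// mulfVK ?gt_eqF.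
have [s hs] := choice net.
pose b n p := dball dist p (2 * r n).
have r20 n : 0 < 2 * r n by rewrite mulr_gt0.
pose f n p y := `|u y - avg mu u (b n p)| + osc p (2 * r n).
have f0 n p y : 0 <= f n p y by rewrite addr_ge0// osc_ge0.
have mb n p : measurable (b n p) by exact: dball_measurable.
(* [H n] has integral at most [2 * 2 ^ - n], so the sum over [n] is integrable and [H n x] tends to
   0 for almost every [x]. *)
pose H n x := \sum_(p <- s n) (f n p \_ (b n p)) x.
have fb0 n p x : 0 <= (f n p \_ (b n p)) x by rewrite patchE; case: ifP.
have H0 n x : 0 <= H n x by apply: sumr_ge0.
have mfb n p : measurable_fun setT (EFin \o (f n p \_ (b n p))).
  apply/measurable_EFinP; apply/(measurable_restrictT _ (mb n p)).
  by have [/integrableP[/measurable_EFinP]] := integral_osc_ball p _ (r20 n).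
have mH n : measurable_fun setT (EFin \o H n).
  rewrite (_ : EFin \o H n = fun x => (\sum_(p <- s n) (EFin \o (f n p \_ (b n p))) x)%E).
    exact: emeasurable_sum.
  by apply/funext => x /=; rewrite /H -sumEFin.
have iH n : (\int[mu]_x (H n x)%:E <= (2 * 2^-1 ^+ n)%:E)%E.
  have -> : (\int[mu]_x (H n x)%:E = \sum_(p <- s n) \int[mu]_x ((f n p \_ (b n p)) x)%:E)%E.
    rewrite -ge0_integral_sum//; [|by move=> p; exact: mfb|by move=> p x _; rewrite lee_fin].
    by apply: eq_integral => x _; rewrite /H -sumEFin.
  rewrite (eq_bigr (fun p => (2 * (osc p (2 * r n) * mball dist mu p (2 * r n)))%:E)); last first.
    move=> p _; have [_ <-] := integral_osc_ball p _ (r20 n).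
    rewrite [RHS]integral_mkcond; apply: eq_integral => x _.
    by rewrite !patchE; case: ifP.
  rewrite sumEFin lee_fin -big_distrr /= ler_pM2l//.
  apply: le_trans (rA n); have [ps sT _] := hs n.
  apply: le_trans (hN point (T n) (r n) (s n) _ (r0 n) (r1 n) ps sT) _; first by rewrite ltr0n.
  by rewrite /A le_eqVlt; apply/orP; left; apply/eqP; ring.
have iS : (\int[mu]_x (\sum_(0 <= n <oo) (H n x)%:E) < +oo)%E.
  rewrite integral_nneseries//; last by move=> n x _; rewrite lee_fin.
  apply: (@le_lt_trans _ _ (2 * 2)%:E); last exact: ltry.
  apply: le_trans (lee_nneseries _ (fun n _ => iH n)) _.
    by move=> n _ _; apply: integral_ge0 => x _; rewrite lee_fin.
  apply: nneseries_le_bound => [n|n]; first by rewrite mulr_ge0// exprn_ge0// invr_ge0.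
  rewrite -big_distrr /= ler_pM2l//.
  apply: le_trans (geometric_sum_le R _ n _ h1) _; first by rewrite invr_ge0.
  by rewrite (_ : 1 - 2^-1 = 2^-1) ?invrK//; field.
have mS : measurable_fun setT (fun x => (\sum_(0 <= n <oo) (H n x)%:E)%E).
  exact: (ge0_emeasurable_sum (h := fun n x => (H n x)%:E) (P := predT)
    (fun n x _ _ => H0 n x) (fun n _ => mH n)).
have S0 x : (0 <= \sum_(0 <= n <oo) (H n x)%:E)%E.
  by apply: nneseries_ge0 => n _ _; rewrite lee_fin.
have intS : mu.-integrable setT (fun x => (\sum_(0 <= n <oo) (H n x)%:E)%E).
  apply/integrableP; split=> //.
  by rewrite (eq_integral (fun x => (\sum_(0 <= n <oo) (H n x)%:E)%E))// => x _; rewrite gee0_abs.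
exists r; split=> //.
  apply: (@squeeze_cvgr _ _ _ _ (cst 0) (fun n => 2^-1 ^+ n)).
  - by apply: nearW => n; rewrite r2n ltW//= r0.
  - exact: cvg_cst.
  - by apply: cvg_expr; rewrite ger0_norm// invr_ge0.
have := integrable_ae measurableT intS; apply: filterS => x /(_ I) fx.
have cH : (fun n => H n x) @ \oo --> (0 : R).
  apply: cvg_series_cvg_0; apply: nnseries_is_cvg => //.
  by rewrite -ge0_fin_numE.
have [L L1 hL] := mball_dilate hd hopen hpos hdbl 3.
have L0 : 0 < L + 1 by lra.
apply/cvgrPdist_le => e e0.
have [n1 _ hn1] := (@cvgrPdist_le _ _ _ _ _ _ _).1 cH (e / (L + 1)) (divr_gt0 e0 L0).
exists (maxn n1 (Num.truncn (dist point x))) => // n /= nn.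
have xT : dball dist point (T n) x.
  rewrite /dball /= (lt_le_trans (truncnS_gt _))// /T ler_nat ltnS.
  by rewrite (leq_trans _ nn)// leq_maxr.
have [ps sT /(_ x xT)[p pin xp]] := hs n.
have He : H n x <= e / (L + 1).
  have := hn1 n (leq_trans (leq_maxl _ _) nn).
  by rewrite /= sub0r normrN ger0_norm.
have xb : b n p x by rewrite /b /dball /= (dist_sym hd); have := r0 n; lra.
have fH : f n p x <= H n x.
  rewrite /H (perm_big _ (perm_to_rem pin)) big_cons /= patchE mem_set// lerDl.
  exact: sumr_ge0.
have d1 : `|avg mu u (dball dist x (r n)) - avg mu u (b n p)| <= L * osc p (2 * r n).
  apply: avg_ball_diff => //.
    by apply: dball_sub => //; rewrite (dist_sym hd); lra.
  by apply: hL => //; apply: dball_sub => //; lra.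
(* The average over the net ball is within [H n x] of [u x] and within [L * H n x] of the average
   over [B(x, r n)]. *)
have eL : H n x * (L + 1) <= e by rewrite -ler_pdivlMr.
have d2 : `|u x - avg mu u (b n p)| <= H n x.
  by apply: le_trans fH; rewrite /f lerDl osc_ge0.
have d3 : L * osc p (2 * r n) <= L * H n x.
  apply: ler_wpM2l; first exact: (le_trans ler01 L1).
  by apply: le_trans fH; rewrite /f lerDr.
clear - d1 d2 d3 eL; move: d1 d2; rewrite !ler_norml => /andP[? ?] /andP[? ?].
by apply/andP; split; lra.
Qed.


(** * The exceptional set and the representative of [u] *)

Lemma nu_separated r s : 0 < r -> pairwise (fun p q => 2 * r <= dist p q) s ->
  \sum_(p <- s) nu (dball dist p r) <= nu setT.
Proof.
move=> r0 ps; rewrite -[leRHS]mul1r.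
apply: (overlap_Rintegral (A := fun p => dball dist p r)) => //.
- by move=> p; exact: dball_measurable.
- exact: powR_g_integrable.
- by move=> y; exact: powR_ge0.
- have := separated_overlap hd ps; rewrite (_ : 2 * r / 2 = r)//.
  by rewrite mulrC mulKf.
Qed.

Lemma lebesgue_points (eps : R) : 0 < eps -> exists E : set X,
  hausdorff dist (gauge_log Q eps) E = 0%E /\
  exists ut : X -> R,
    {ae mu, forall x, ut x = u x} /\
    forall x, ~ E x -> avg mu u (dball dist x r) @[r --> 0^'+] --> ut x.
Proof.
move=> e0.
pose beta := Q - 1 + eps / 2.
have b0 : 0 < beta by rewrite /beta; have := Q1; lra.
have bQ : Q - 1 < beta by rewrite /beta; lra.
have be : beta < Q - 1 + eps by rewrite /beta; lra.
exists [set x | forall J, exists2 j, (J <= j)%N &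
       powR 2 (- (j%:R * beta)) < nu (dball dist x (2^-1 ^+ (2 ^ j)))].
split; first exact: (hausdorff_exceptional hd b0 be nu_separated).
pose F x : set_system R := avg mu u (dball dist x r) @[r --> 0^'+].
(* The representative is the limit wherever it exists and [u] elsewhere. Where it exists it equals
   the limit along the radii of [avg_cvg_ae], hence [u x] for almost every such [x]. *)
exists (fun x => if `[< cvg (F x) >] then lim (F x) else u x); split; last first.
  move=> x /existsNP[J hJ].
  have [l hl] : exists l : R, F x --> l.
    apply: (avg_cvg x beta J bQ) => j Jj; rewrite leNgt; apply/negP => h.
    by apply: hJ; exists j.
  have cF : cvg (F x) by apply/cvg_ex; exists l.
  by rewrite asboolT.
have [r [r0 rlim]] := avg_cvg_ae; apply: filterS => x ux.
case: asboolP => // cF.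
have h : avg mu u (dball dist x (r n)) @[n --> \oo] --> lim (F x).
  by move/cvg_at_rightP: cF; apply.
exact: (cvg_unique _ h ux).
Qed.

End Poincare.

Theorem theoremB (R : realType) (d : measure_display) (X : measurableType d)
  (dist : X -> X -> R) (mu : {measure set X -> \bar R})
  (Q eps : R) (u g : X -> R) (C lam : R) :
  1 < Q -> 0 < eps ->
  (* (X, d) is a metric space *)
  is_metric dist ->
  (* mu is a Borel regular measure: open sets are measurable and every
     measurable set is contained in a Borel set of the same measure *)
  (forall A, d_open dist A -> measurable A) ->
  (forall A, measurable A -> exists B,
      <<s [set O | d_open dist O] >> B /\ A `<=` B /\ mu A = mu B) ->
  (* mu is doubling *)
  (forall x r, 0 < r -> (0 < mu (dball dist x r) < +oo)%E) ->
  (exists Cmu : R, forall x r, 0 < r ->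
      (mu (dball dist x (2 * r)) <= Cmu%:E * mu (dball dist x r))%E) ->
  (* Q-doubling *)
  (exists C0 : R, 1 <= C0 /\ forall (a x : X) (r s : R),
      dball dist a r x -> 0 < s -> s <= r ->
      powR (s / r) Q <= C0 * fine (mu (dball dist x s)) / fine (mu (dball dist a r))) ->
  (* chain condition *)
  chain_condition dist ->
  (* u integrable on balls *)
  (forall x r, 0 < r -> mu.-integrable (dball dist x r) (EFin \o u)) ->
  (* g in L^Q(X), g >= 0 *)
  measurable_fun setT g -> (forall x, 0 <= g x) ->
  (\int[mu]_x (powR (g x) Q)%:E < +oo)%E ->
  (* the Poincare-type inequality *)
  0 < C -> 1 <= lam ->
  (forall B : X * R, 0 < B.2 ->
     avg mu (fun y => `|u y - avg mu u (ballp dist B)|) (ballp dist B)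
     <= C * fine (diam dist (ballp dist B)) *
        powR (avg mu (fun y => powR (g y) Q) (ballp dist (sball lam B))) (Q^-1)) ->
  exists E : set X,
    hausdorff dist (gauge_log Q eps) E = 0%E /\
    exists ut : X -> R,
      {ae mu, forall x, ut x = u x} /\
      forall x, ~ E x ->
        (fun r => avg mu u (dball dist x r)) @ 0^'+ --> ut x.
Proof.
move=> Q1 eps0 hd hopen _ hpos hdbl hQ hchain hu mg _ gQ C0 lam1 hP.
exact: (lebesgue_points R d X dist mu Q u g C lam).
Qed.
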